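(* Let $\theta\in(0,1)$ be irrational, let $\alpha_1,\alpha_{-1},\beta_1,\beta_{-1}\in\mathbb{C}$, let $M=\max\{|\alpha_1|,|\alpha_{-1}|,|\beta_1|,|\beta_{-1}|\}$, and let $$H_\theta = \alpha_1U_\theta+\alpha_{-1}U_\theta^*+\beta_1V_\theta+\beta_{-1}V_\theta^*\in A_\theta.$$ For a positive integer $n$ and an integer $p_n\in\{0,1,\ldots,n-1\}$ with $|\theta-\frac{p_n}{n}|\le\frac{1}{2n}$, let $$h_n=\alpha_1u_{\frac{p_n}{n}}+\alpha_{-1}u_{\frac{p_n}{n}}^*+\beta_1v_{\frac{p_n}{n}}+\beta_{-1}v_{\frac{p_n}{n}}^*\in M_n(\mathbb{C}).$$ Then: (1) There is a constant $C_1$ with $0\le C_1\le 36M\sqrt{3\pi}$ such that for every such $n$ and $p_n$ and every $\varepsilon>0$, $$\sigma^{(\varepsilon)}(h_n)\subset\sigma^{(\varepsilon+\frac{C_1}{\sqrt n})}(H_\theta).$$ (2) If $H_\theta$ is normal and $M>0$, then there is a constant $C_1$ with $0< C_1\le 36M\sqrt{3\pi}$ such that for every such $n$ and $p_n$, $$\sigma(h_n)\subset^{\frac{C_1}{\sqrt n}}\sigma(H_\theta).$$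
   Context: Irrational rotation algebra: $A_\theta$ is the universal C$^*$-algebra generated by two unitaries $U_\theta,V_\theta$ subject to $U_\theta V_\theta=e^{2\pi i\theta}V_\theta U_\theta$. Matrices: for integers $p,q$ with $q\ge1$ and $0\le p<q$, let $\omega=e^{2\pi ip/q}$. Then $u_{\frac pq}\in M_q(\mathbb{C})$ is the cyclic shift matrix with entries $1$ at positions $(j,j+1)$ for $1\le j\le q-1$ and at position $(q,1)$, and $0$ elsewhere; and $v_{\frac pq}=\mathrm{diag}(1,\omega,\omega^2,\ldots,\omega^{q-1})\in M_q(\mathbb{C})$. For $q=1$ both are the $1\times1$ matrix $(1)$. Here $u_{\frac{p_n}{n}}, v_{\frac{p_n}{n}}$ are taken of size $n\times n$ (with $q=n$), even if $p_n$ and $n$ are not coprime. Spectra: $\sigma(T)$ is the spectrum of $T$. For $\varepsilon>0$ the $\varepsilon$-pseudospectrum of a bounded Hilbert space operator (or of an element of a unital C$^*$-algebra, viewed as an operator via any faithful unital representation) is $\sigma^{(\varepsilon)}(T)=\{\lambda\in\mathbb{C}:\|(\lambda-T)^{-1}\|\ge\frac1\varepsilon\}$, with the convention $\|X^{-1}\|=\infty$ if $X$ is not invertible; matrices carry the operator norm. Notation: for compact $\Lambda,\Sigma\subset\mathbb{C}$ and $\delta>0$, $\Lambda\subset^{\delta}\Sigma$ means that for each $\lambda\in\Lambda$ there exists $\sigma\in\Sigma$ with $|\lambda-\sigma|<\delta$. *)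

(* Defs.v *)
From HB Require Import structures.
From mathcomp Require Import all_boot all_order all_algebra.
From mathcomp Require Import complex.
From mathcomp Require Import all_classical all_reals all_analysis.

Set Implicit Arguments.
Unset Strict Implicit.
Unset Printing Implicit Defensive.

Import Order.TTheory GRing.Theory Num.Theory.
Import numFieldNormedType.Exports.

Local Open Scope classical_set_scope.
Local Open Scope ring_scope.

(* Over the scalar field R[i] the library norm takes its values in R[i]
   (on the nonnegative real axis); rnorm is the same number as an element of R. *)
Definition rnorm (R : realType) (V : normedZmodType R[i]) (x : V) : R :=
  complex.Re `|x|.

(* exp(2 pi i t) *)
Definition cexp2pi (R : realType) (t : R) : R[i] :=
  Complex (cos (2 * pi * t)) (sin (2 * pi * t)).

(* Unital C*-algebras with 1 != 0, on a complete normed space. A single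
   HB structure joining GRing.Algebra and CompleteNormedModule cannot be declared
   on top of the existing hierarchy (missing join with Num.NumDomain), so
   multiplication and unit are given as data here and the algType instance of
   the carrier is derived below. *)
Record cstarAlg (R : realType) := CStarAlg {
  cstar_space : completeNormedModType R[i];
  cstar_one : cstar_space;
  cstar_mul : cstar_space -> cstar_space -> cstar_space;
  cstar_star : cstar_space -> cstar_space;
  cstar_mulA : associative cstar_mul;
  cstar_mul1l : left_id cstar_one cstar_mul;
  cstar_mul1r : right_id cstar_one cstar_mul;
  cstar_mulDl : left_distributive cstar_mul +%R;
  cstar_mulDr : right_distributive cstar_mul +%R;
  cstar_one_neq0 : cstar_one != 0;
  cstar_scaleAl : forall (c : R[i]) x y,
    c *: cstar_mul x y = cstar_mul (c *: x) y;
  cstar_scaleAr : forall (c : R[i]) x y,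
    c *: cstar_mul x y = cstar_mul x (c *: y);
  cstar_starK : involutive cstar_star;
  cstar_starD : {morph cstar_star : x y / x + y};
  cstar_starZ : forall (c : R[i]) x, cstar_star (c *: x) = c^* *: cstar_star x;
  cstar_starM : forall x y,
    cstar_star (cstar_mul x y) = cstar_mul (cstar_star y) (cstar_star x);
  cstar_normM : forall x y, `|cstar_mul x y| <= `|x| * `|y|;
  cstar_identity : forall x, `|cstar_mul (cstar_star x) x| = `|x| ^+ 2 }.

Definition cstar_sort (R : realType) (A : cstarAlg R) : Type := cstar_space A.
Coercion cstar_sort : cstarAlg >-> Sortclass.

Section CStarInstances.
Variables (R : realType) (A : cstarAlg R).

HB.instance Definition _ :=
  CompleteNormedModule.copy (cstar_sort A) (cstar_space A).
HB.instance Definition _ := GRing.Zmodule_isNzRing.Build (cstar_sort A)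
  (@cstar_mulA R A) (@cstar_mul1l R A) (@cstar_mul1r R A)
  (@cstar_mulDl R A) (@cstar_mulDr R A) (@cstar_one_neq0 R A).
HB.instance Definition _ := GRing.Lmodule_isLalgebra.Build R[i] (cstar_sort A)
  (@cstar_scaleAl R A).
HB.instance Definition _ := GRing.Lalgebra_isAlgebra.Build R[i] (cstar_sort A)
  (@cstar_scaleAr R A).

Definition star (x : A) : A := @cstar_star R A x.

End CStarInstances.

Section CStar.
Context {R : realType}.

Definition unitary (A : cstarAlg R) (u : A) :=
  star u * u = 1 /\ u * star u = 1.

Definition normal (A : cstarAlg R) (a : A) := star a * a = a * star a.

Definition spectrum (A : cstarAlg R) (a : A) : set R[i] :=
  [set l | ~ exists b : A, (l%:A - a) * b = 1 /\ b * (l%:A - a) = 1].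

Definition cstar_subalgebra (A : cstarAlg R) (S : set A) :=
  [/\ closed S, S 1,
      forall (c : R[i]) x y, S x -> S y -> S (c *: x + y),
      forall x y, S x -> S y -> S (x * y)
    & forall x, S x -> S (star x)].

(* Pairs of unitaries with U V = exp(2 pi i theta) V U. *)
Definition rotation_pair (theta : R) (A : cstarAlg R) (U V : A) :=
  [/\ unitary U, unitary V & U * V = cexp2pi theta *: (V * U)].

(* A is the universal C*-algebra generated by such a pair U, V. *)
Definition rotation_algebra (theta : R) (A : cstarAlg R) (U V : A) :=
  [/\ rotation_pair theta U V,
      forall S : set A, cstar_subalgebra S -> S U -> S V -> S = setT
    & forall (B : cstarAlg R) (u v : B), rotation_pair theta u v ->
        exists f : {lrmorphism A -> B},
          [/\ forall x, f (star x) = star (f x), f U = u & f V = v]].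

End CStar.

(* Hilbert spaces: the inner product is linear in its first argument. *)
Record hilbertSpace (R : realType) := HilbertSpace {
  hilbert_sort :> completeNormedModType R[i];
  inner : {dot hilbert_sort for @Num.conj R[i]};
  inner_norm : forall x : hilbert_sort, `|x| ^+ 2 = inner x x }.

Section Operators.
Context {R : realType}.

Definition bounded_op (K : hilbertSpace R) (T : K -> K) :=
  exists M : R, forall x, rnorm (T x) <= M * rnorm x.

Definition opnorm (K : hilbertSpace R) (T : K -> K) : R :=
  sup [set rnorm (T x) | x in [set x | rnorm x <= 1]].

(* S is the inverse of T in B(K). *)
Definition op_inverse (K : hilbertSpace R) (T : K -> K) (S : {linear K -> K}) :=
  [/\ bounded_op S, cancel T S & cancel S T].

(* The condition on S is void when l - T is not invertible, in accordance with
   the convention that the norm of the inverse is then infinite. *)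
Definition op_pseudospectrum (K : hilbertSpace R) (T : K -> K) (eps : R) :
    set R[i] :=
  [set l | forall S : {linear K -> K},
     op_inverse (fun x => l *: x - T x) S -> eps^-1 <= opnorm S].

(* Unital *-representations of A on K. *)
Record representation (A : cstarAlg R) (K : hilbertSpace R) :=
  Representation {
  rep :> A -> {linear K -> K};
  rep_bounded : forall a, bounded_op (rep a);
  repD : forall a b x, rep (a + b) x = rep a x + rep b x;
  repZ : forall c a x, rep (c *: a) x = c *: rep a x;
  repM : forall a b x, rep (a * b) x = rep a (rep b x);
  rep1 : forall x, rep 1 x = x;
  rep_star : forall a x y,
    @inner R K (rep a x) y = @inner R K x (rep (star a) y) }.

Definition faithful (A : cstarAlg R) (K : hilbertSpace R)
    (rho : representation A K) :=
  forall a, (forall x, rho a x = 0) -> a = 0.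

(* a is viewed as an operator via any faithful unital representation; the
   result does not depend on the representation, and one exists for every A
   (Gelfand-Naimark). *)
Definition pseudospectrum (A : cstarAlg R) (a : A) (eps : R) : set R[i] :=
  [set l | forall (K : hilbertSpace R) (rho : representation A K),
     faithful rho -> op_pseudospectrum (rho a) eps l].

End Operators.

Section Matrices.
Context {R : realType}.
Local Open Scope sesquilinear_scope.

Definition enorm n (x : 'cV[R[i]]_n) : R :=
  Num.sqrt (\sum_(i < n) rnorm (x i 0) ^+ 2).

Definition mx_opnorm n (h : 'M[R[i]]_n) : R :=
  sup [set enorm (h *m x) | x in [set x | enorm x <= 1]].

Definition mx_spectrum n (h : 'M[R[i]]_n) : set R[i] :=
  [set l | l%:M - h \notin unitmx].

(* Same convention as in op_pseudospectrum when l - h is singular. *)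
Definition mx_pseudospectrum n (h : 'M[R[i]]_n) (eps : R) : set R[i] :=
  [set l | l%:M - h \in unitmx -> eps^-1 <= mx_opnorm (invmx (l%:M - h))].

(* Indices run over 0, ..., n-1; for n = 1 this is the identity. *)
Definition shift_mx n : 'M[R[i]]_n :=
  \matrix_(i < n, j < n) (nat_of_ord j == (i.+1 %% n)%N)%:R.

Definition clock_mx (n p : nat) : 'M[R[i]]_n :=
  diag_mx (\row_(j < n) cexp2pi (p%:R / n%:R) ^+ j).

Definition rotation_elt (A : cstarAlg R) (U V : A)
    (a1 am1 b1 bm1 : R[i]) : A :=
  a1 *: U + am1 *: star U + b1 *: V + bm1 *: star V.

Definition rotation_mx (n p : nat) (a1 am1 b1 bm1 : R[i]) : 'M[R[i]]_n :=
  a1 *: shift_mx n + am1 *: (shift_mx n) ^t*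
    + b1 *: clock_mx n p + bm1 *: (clock_mx n p) ^t*.

End Matrices.

(* The relation written Lambda \subset^delta Sigma. *)
Definition subset_upto (R : realType) (delta : R) (L S : set R[i]) :=
  forall l, L l -> exists2 s, S s & rnorm (l - s) < delta.

(* Main.v *)
Require Import Defs.
From mathcomp Require Import all_boot all_order all_algebra.
From mathcomp Require Import complex.
From mathcomp Require Import all_classical all_reals all_analysis.
From mathcomp Require Import ring lra zify.

Set Implicit Arguments.
Unset Strict Implicit.
Unset Printing Implicit Defensive.

Import Order.TTheory GRing.Theory Num.Theory.
Import numFieldNormedType.Exports.

Local Open Scope classical_set_scope.
Local Open Scope ring_scope.


(** The matrix [h] acts on [n]-periodic sequences and is a discrete Schroedinger
    operator with frequency [p / n]; in suitable vectors of any space on which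
    the rotation relation is realized, the element [H] acts as the same operator
    on finitely supported sequences over the integers, with frequency [theta].
    The two operators are close on short windows, and a window of length about
    [sqrt n] gives the rate.

    Localization ([localization]).  Let [x] satisfy
    [|(lam - h) x| <= eps |x|].  Cut [x] by a tent [g] of half-width [L],
    translated along the cycle.  On each window the commutator of [h] with [g]
    costs [1 / L] relative to the size of [g], and replacing [p / n] by [theta]
    costs a phase error of at most [pi L / n] once the phases are matched at the
    centre of the window.  Squares are summed over all translates, so that every
    entry of [x] has the same total weight; with [L ~ sqrt n] this shows that a
    lower bound [kappa] for all the windowed operators satisfies
    [kappa <= eps + 21 M / sqrt n].

    Transfer ([lower_bound_transfer]).  Let [U], [V] be unitary with
    [U V = q V U].  Every point [z] of the unit circle is an approximate
    eigenvalue of [V] ([approx_eigenvector]): this is where irrationality enters,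
    through an average over powers of [U] which makes the vectors [V^k xi]
    orthogonal in the mean.  If [x] is an approximate eigenvector for [z], then
    the vectors [U^-j x] are approximate eigenvectors of [V] for the distinct
    values [z q^j], hence almost orthonormal ([approx_eigen_orthogonal]), and [U]
    shifts them.  So finitely supported sequences embed almost isometrically, and
    a lower bound for [lam - H] passes to the windowed operators.

    All of this uses only an inner product [ip] with [|ip x x| = |x|^2] and
    values in a normed space ([rotation_frame]).  A Hilbert space carrying a
    representation is one instance; the algebra itself, with
    [ip x y = star y * x], is another, thanks to the C*-identity.

    For pseudospectra, the first instance applied to [kappa = 1 / |S|], where [S]
    is the inverse of [lam - H], gives the inclusion.  For spectra, suppose that
    the open disc of radius [r] about an eigenvalue [lam] of [h] misses the
    spectrum of [H].  As [H] is normal, [b = (lam - H)^-1] satisfies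
    [|b| <= 1 / r] ([rnorm_normal_resolvent]); the second instance with
    [kappa = r] and [eps] tending to [0] then yields [r <= 21 M / sqrt n], while
    [21 < 36 sqrt (3 pi)]. *)

(** * Real-valued norms *)

Section RealNorm.
Context {R : realType}.
Local Open Scope complex_scope.

Section Zmod.
Variable V : normedZmodType R[i].
Implicit Types x y : V.

Lemma rnormE x : (rnorm x)%:C = `|x|.
Proof. by rewrite /rnorm RRe_real// normr_real. Qed.

Lemma rnorm_ge0 x : 0 <= rnorm x.
Proof. by rewrite -ler0c rnormE. Qed.

Lemma rnormD x y : rnorm (x + y) <= rnorm x + rnorm y.
Proof. by rewrite -lecR rmorphD /= !rnormE ler_normD. Qed.

Lemma rnormN x : rnorm (- x) = rnorm x.
Proof. by rewrite /rnorm normrN. Qed.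

Lemma rnormB x y : rnorm (x - y) <= rnorm x + rnorm y.
Proof. by rewrite -(rnormN y) rnormD. Qed.

Lemma rnorm0 : rnorm (0 : V) = 0.
Proof. by rewrite /rnorm normr0. Qed.

Lemma rnorm_eq0 x : (rnorm x == 0) = (x == 0).
Proof. by rewrite -(inj_eq (@complexI R)) rnormE normr_eq0. Qed.

Lemma rnorm_gt0 x : (0 < rnorm x) = (x != 0).
Proof. by rewrite lt_neqAle rnorm_ge0 andbT eq_sym rnorm_eq0. Qed.

Lemma rnorm_sum I (r : seq I) (P : pred I) (F : I -> V) :
  rnorm (\sum_(i <- r | P i) F i) <= \sum_(i <- r | P i) rnorm (F i).
Proof.
elim/big_rec2: _ => [|i a b _ h]; first by rewrite rnorm0.
by rewrite (le_trans (rnormD _ _))// lerD2l.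
Qed.

End Zmod.

Lemma rnormZ (V : normedModType R[i]) (c : R[i]) (x : V) :
  rnorm (c *: x) = rnorm c * rnorm x.
Proof. by apply: (@complexI R); rewrite rmorphM /= !rnormE normrZ. Qed.

Implicit Types z w : R[i].

Lemma rnormM z w : rnorm (z * w) = rnorm z * rnorm w.
Proof. by apply: (@complexI R); rewrite rmorphM /= !rnormE normrM. Qed.

Lemma rnorm1 : rnorm (1 : R[i]) = 1.
Proof. by rewrite /rnorm normr1. Qed.

Lemma rnormX z k : rnorm (z ^+ k) = rnorm z ^+ k.
Proof. by elim: k => [|k IH]; rewrite ?expr0 ?rnorm1// !exprS rnormM IH. Qed.

Lemma rnormV z : rnorm z^-1 = (rnorm z)^-1.
Proof. by apply: (@complexI R); rewrite fmorphV /= !rnormE normfV. Qed.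

Lemma rnorm_real (a : R) : rnorm a%:C = `|a|.
Proof. by rewrite /rnorm normc_def /= expr0n /= addr0 sqrtr_sqr. Qed.

Lemma rnorm_nat k : rnorm (k%:R : R[i]) = k%:R.
Proof. by rewrite -(rmorph_nat (real_complex R)) rnorm_real normr_nat. Qed.

Lemma rnorm_conj z : rnorm (z^*)%R = rnorm z.
Proof. by rewrite /rnorm norm_conjC. Qed.

Lemma sqr_rnorm z : rnorm z ^+ 2 = complex.Re z ^+ 2 + complex.Im z ^+ 2.
Proof.
rewrite /rnorm normc_def /= sqr_sqrtr//.
by rewrite addr_ge0// sqr_ge0.
Qed.

Lemma conj_unit z : rnorm z = 1 -> (z^*)%R * z = 1.
Proof.
move=> z1; rewrite mulrC -normCK -rnormE z1.
by rewrite -rmorphXn /= expr1n.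
Qed.

End RealNorm.

(** * Points of the unit circle *)

Section Cexp.
Context {R : realType}.
Local Open Scope complex_scope.
Implicit Types s t : R.

Lemma cexp2piD s t : cexp2pi (s + t) = cexp2pi s * cexp2pi t.
Proof.
rewrite /cexp2pi mulrDr cosD sinD; apply/eqP; rewrite eq_complex /=.
by apply/andP; split; apply/eqP; ring.
Qed.

Lemma cexp2pi0 : cexp2pi (0 : R) = 1.
Proof. by rewrite /cexp2pi mulr0 cos0 sin0. Qed.

Lemma rnorm_cexp2pi t : rnorm (cexp2pi t) = 1.
Proof.
apply/eqP; rewrite -(eqrXn2 (_ : (0 < 2)%N)) ?rnorm_ge0//.
by rewrite sqr_rnorm /= cos2Dsin2 expr1n.
Qed.

Lemma cexp2piMn t k : cexp2pi (k%:R * t) = cexp2pi t ^+ k.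
Proof.
elim: k => [|k IH]; first by rewrite mul0r cexp2pi0 expr0.
by rewrite -natr1 mulrDl mul1r cexp2piD IH exprSr.
Qed.

Lemma cexp2pi1 : cexp2pi (1 : R) = 1.
Proof.
by rewrite /cexp2pi mulr1 mulrC mulr_natr cos2pi sin2pi.
Qed.

Lemma cexp2pi_nat k : cexp2pi (k%:R : R) = 1.
Proof. by rewrite -[k%:R]mulr1 cexp2piMn cexp2pi1 expr1n. Qed.

Lemma cexp2pi_half : cexp2pi (2^-1 : R) = -1.
Proof.
rewrite /cexp2pi mulrAC divff// mul1r cospi sinpi.
by apply/eqP; rewrite eq_complex /= oppr0 !eqxx.
Qed.

(** The mean value theorem, as [cos] is bounded by [1]. *)
Lemma norm_sin_le t : `|sin t| <= `|t|.
Proof.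
wlog t0 : t / 0 < t => [H|].
  case: (ltgtP t 0) => [t0|t0|->]; last by rewrite sin0.
  - by rewrite -[`|sin t|]normrN -sinN -[`|t|]normrN H// oppr_gt0.
  - exact: H.
have cs : {within `[0, t], continuous sin} :> Prop.
  by apply: continuous_subspaceT; exact: continuous_sin.
have [c _] := @MVT R sin cos 0 t t0 (fun x _ => is_derive_sin x) cs.
rewrite sin0 !subr0 => ->; rewrite normrM ler_piMl//.
by rewrite ler_norml cos_geN1 cos_le1.
Qed.

(** The chord between two points of the unit circle is shorter than the arc. *)
Lemma rnorm_cexp2piB s t :
  rnorm (cexp2pi s - cexp2pi t) <= 2 * pi * `|s - t|.
Proof.
have pi0 := pi_ge0 R.
set d := pi * (s - t).
have chord : rnorm (cexp2pi s - cexp2pi t) ^+ 2 = (2 * sin d) ^+ 2.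
  rewrite sqr_rnorm /=.
  have e : 2 * pi * s - 2 * pi * t = d *+ 2 by rewrite /d; ring.
  have := cosB (2 * pi * s) (2 * pi * t); rewrite e cos_mulr2n.
  have := cos2Dsin2 (2 * pi * s); have := cos2Dsin2 (2 * pi * t).
  have := cos2Dsin2 d; set a := cos _; set b := sin _; set a1 := cos _.
  set b1 := sin _; set a2 := cos _; set b2 := sin _ => h1 h2 h3 h4.
  rewrite mulr2n in h4.
  nra.
rewrite -[leLHS]ger0_norm ?rnorm_ge0// -[leRHS]ger0_norm ?mulr_ge0//.
rewrite -ler_sqr ?nnegrE// !real_normK ?num_real// chord.
rewrite -[leLHS]real_normK ?num_real// -[leRHS]real_normK ?num_real//.
rewrite ler_sqr ?nnegrE// !normrM (ger0_norm pi0) normr_id -mulrA ler_wpM2l//.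
by apply: le_trans (norm_sin_le _) _; rewrite /d normrM (ger0_norm pi0).
Qed.

(** Full turns removed, an irrational angle leaves a fraction [t] of a turn
    with [0 < t < 1], for which [sin (pi t)] is positive. *)
Lemma cexp2pi_irrational_neq1 (theta : R) k :
  0 < theta -> irrational theta -> (0 < k)%N -> cexp2pi theta ^+ k != 1.
Proof.
move=> th0 irr k0; rewrite -cexp2piMn; set a := k%:R * theta.
have a0 : 0 <= a by rewrite mulr_ge0// ltW.
have ha := floor_itv a.
have fl0 : 0 <= Num.floor a by rewrite floor_ge0.
set m := `|Num.floor a|%N.
have mE : (Num.floor a)%:~R = m%:R :> R.
  by rewrite -[in LHS](gez0_abs fl0) -pmulrn.
have aE : a = m%:R + (a - m%:R) by ring.
rewrite aE cexp2piD cexp2pi_nat mul1r; set t := a - m%:R.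
have t0 : 0 < t.
  rewrite subr_gt0 lt_neqAle; apply/andP; split; last first.
    by move: ha => /andP[+ _]; rewrite mE.
  apply/eqP => mk; apply: irr; apply/rationalP.
  exists (Num.floor a), k; rewrite mE mk /a mulrAC divff ?mul1r//.
  by rewrite pnatr_eq0 -lt0n.
have t1 : t < 1.
  by rewrite ltrBlDl; move: ha => /andP[_]; rewrite intrD mE.
have s0 : 0 < sin (pi * t).
  apply: sin_gt0_pi; rewrite mulr_gt0 ?pi_gt0//=.
  by rewrite gtr_pMr ?pi_gt0.
apply/eqP => /(congr1 (@complex.Re R)) /=.
have -> : 2 * pi * t = (pi * t) *+ 2 by ring.
have := cos2Dsin2 (pi * t).
rewrite cos_mulr2n mulr2n => h1 h2; nra.
Qed.

End Cexp.

(** * Frames for the rotation relation *)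

(** The common structure of a Hilbert space that carries a representation of the
    rotation algebra (with [Y] the scalars) and of the algebra itself, seen as a
    right Hilbert module over itself (with [X = Y] and [ip x y = star y * x]).
    For the latter the inner product is not scalar-valued, so positivity is
    replaced by the norm identity [rnorm_ip], which is the C*-identity. *)
Record rotation_frame (R : realType) (theta : R) (X Y : normedModType R[i]) :=
  RotationFrame {
  rU : {linear X -> X};
  rUi : {linear X -> X};
  rV : {linear X -> X};
  rVi : {linear X -> X};
  ip : X -> X -> Y;
  rUiK : cancel rUi rU;
  rUK : cancel rU rUi;
  rVK : cancel rV rVi;
  rViK : cancel rVi rV;
  rUV : forall x, rU (rV x) = cexp2pi theta *: rV (rU x);
  ipDl : forall x y z, ip (x + y) z = ip x z + ip y z;
  ipDr : forall x y z, ip x (y + z) = ip x y + ip x z;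
  ipZl : forall c x y, ip (c *: x) y = c *: ip x y;
  ipZr : forall (c : R[i]) x y, ip x (c *: y) = c^* *: ip x y;
  ipU : forall x y, ip (rU x) (rU y) = ip x y;
  ipV : forall x y, ip (rV x) (rV y) = ip x y;
  rnorm_ip_le : forall x y, rnorm (ip x y) <= rnorm x * rnorm y;
  rnorm_ip : forall x, rnorm (ip x x) = rnorm x ^+ 2 }.

(** The row of index [j] of the tight-binding operator with potential values
    [mu j] on the half-line.  At [j = 0] the left neighbour is read as the entry
    [0] itself; for [c 0 = 0] this is the boundary value [0]. *)
Definition lattice_op (R : realType) (a1 am1 b1 bm1 : R[i]) (mu c : nat -> R[i])
    (j : nat) : R[i] :=
  a1 * c j.+1 + am1 * c j.-1 + (b1 * mu j + bm1 * (mu j)^*) * c j.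

Section Frame.
Variables (R : realType) (theta : R) (X Y : normedModType R[i]).
Variable F : rotation_frame theta X Y.
Hypotheses (theta_gt0 : 0 < theta) (theta_irr : irrational theta).

Local Notation U := (rU F).
Local Notation Ui := (rUi F).
Local Notation V := (rV F).
Local Notation Vi := (rVi F).
Local Notation ipF := (ip F).
Local Notation q := (cexp2pi theta).
Implicit Types (x y : X) (z : R[i]).

Lemma ip0l y : ipF 0 y = 0.
Proof. by rewrite -(scale0r 0) ipZl scale0r. Qed.

Lemma ip0r x : ipF x 0 = 0.
Proof. by rewrite -(scale0r 0) ipZr conjC0 scale0r. Qed.

Lemma ip_suml I (r : seq I) (P : pred I) (G : I -> X) y :
  ipF (\sum_(i <- r | P i) G i) y = \sum_(i <- r | P i) ipF (G i) y.
Proof. by apply: (big_morph (fun x => ipF x y)) => [a b|]; rewrite ?ip0l ?ipDl. Qed.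

Lemma ip_sumr I (r : seq I) (P : pred I) (G : I -> X) x :
  ipF x (\sum_(i <- r | P i) G i) = \sum_(i <- r | P i) ipF x (G i).
Proof. by apply: (big_morph (ipF x)) => [a b|]; rewrite ?ip0r ?ipDr. Qed.

Lemma rnorm_isometry (T : X -> X) :
  (forall x y, ipF (T x) (T y) = ipF x y) -> forall x, rnorm (T x) = rnorm x.
Proof.
move=> Tip x; apply/eqP; rewrite -(eqrXn2 (_ : (0 < 2)%N)) ?rnorm_ge0//.
by rewrite -!(rnorm_ip F) Tip.
Qed.

Lemma ip_iter (T : X -> X) :
  (forall x y, ipF (T x) (T y) = ipF x y) ->
  forall k x y, ipF (iter k T x) (iter k T y) = ipF x y.
Proof. by move=> Tip; elim=> [|k IH] x y //=; rewrite Tip. Qed.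

Lemma iterUV j k x : iter j U (iter k V x) = q ^+ (j * k) *: iter k V (iter j U x).
Proof.
have step k' y : U (iter k' V y) = q ^+ k' *: iter k' V (U y).
  elim: k' => [|k' IH] /=; first by rewrite expr0 scale1r.
  by rewrite rUV IH linearZ /= scalerA -exprS.
elim: j => [|j IH] /=; first by rewrite mul0n expr0 scale1r.
by rewrite IH linearZ /= step scalerA -exprD mulSn addnC.
Qed.

Lemma q_conj : q^* * q = 1.
Proof. by rewrite conj_unit ?rnorm_cexp2pi. Qed.

(** Conjugating by a power of [U] multiplies the Gram matrix of the vectors
    [V^k xi] entrywise by powers of unimodular numbers; those off the diagonal
    differ from [1], so that averaging over the powers kills them. *)
Lemma ip_iterVU j k l x :
  ipF (iter k V (iter j U x)) (iter l V (iter j U x)) =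
  ((q^*) ^+ k * q ^+ l) ^+ j *: ipF (iter k V x) (iter l V x).
Proof.
have e m : iter m V (iter j U x) = (q^*) ^+ (j * m) *: iter j U (iter m V x).
  by rewrite iterUV scalerA -exprMn q_conj expr1n scale1r.
rewrite !e ipZl ipZr ip_iter; last exact: ipU.
rewrite scalerA rmorphXn /= conjCK exprMn -!exprM.
by rewrite ![(_ * j)%N]mulnC.
Qed.

Lemma qconjX_neq1 k l : k != l -> (q^*) ^+ k * q ^+ l != 1.
Proof.
wlog kl : k l / (k < l)%N => [H kl|_].
  case: (ltngtP k l) (kl) => // h _; first exact: H.
  have := H l k h; rewrite neq_ltn h => /(_ isT).
  apply: contra => /eqP/(congr1 (@Num.conj R[i])).
  by rewrite rmorphM !rmorphXn /= conjCK conjC1 mulrC => ->.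
rewrite -(subnK (ltnW kl)) exprD mulrCA -exprMn q_conj expr1n mulr1.
by rewrite cexp2pi_irrational_neq1// subn_gt0.
Qed.

Lemma rnorm_geom_le (t : R[i]) J : rnorm t = 1 -> t != 1 ->
  rnorm (\sum_(j < J) t ^+ j) <= 2 / rnorm (t - 1).
Proof.
move=> t1 tn1; have t0 : 0 < rnorm (t - 1) by rewrite rnorm_gt0 subr_eq0.
rewrite ler_pdivlMr// mulrC -rnormM -subrX1.
by rewrite (le_trans (rnormB _ _))// rnormX t1 expr1n rnorm1.
Qed.

(** The sum is the finite Fourier transform of the orbit of [x]; its defect as an
    eigenvector for [z] telescopes to two boundary terms, whatever [N]. *)
Lemma telescope_eigen z N x : z^* * z = 1 ->
  let w := \sum_(k < N) (z^*) ^+ k *: iter k V x in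
  V w - z *: w = z *: ((z^*) ^+ N *: iter N V x - x).
Proof.
move=> z1 /=; elim: N => [|N IH].
  by rewrite !big_ord0 linear0 scaler0 subrr expr0 scale1r subrr scaler0.
rewrite !big_ord_recr /= linearD scalerDr opprD addrACA IH.
rewrite linearZ /= !scalerBr !scalerA.
by rewrite [in RHS]exprS [in RHS]mulrA [z * _^*]mulrC z1 mul1r addrC subrKA.
Qed.

Lemma conjX z k : ((z^*) ^+ k)^* = z ^+ k.
Proof. by rewrite rmorphXn /= conjCK. Qed.

(** Let [w j] be the Fourier sum of length [N] along the [V]-orbit of [U^j xi].
    Its defect as an eigenvector is at most [2 |xi|], while the average over
    [j < J] of [ip (w j) (w j)] tends to [N ip xi xi], because the off-diagonal
    terms carry bounded geometric sums.  So some [w j] has norm about [sqrt N],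
    and the relative defect is of order [1 / sqrt N]. *)
Lemma approx_eigenvector z (delta : R) (xi : X) : z^* * z = 1 -> 0 < delta -> xi != 0 ->
  exists2 x, rnorm x = 1 & rnorm (V x - z *: x) <= delta.
Proof.
move=> z1 d0 xi0.
have nz : rnorm z = 1.
  apply/eqP; rewrite -(eqrXn2 (_ : (0 < 2)%N)) ?rnorm_ge0//.
  by rewrite expr2 -{1}(rnorm_conj z) -rnormM z1 rnorm1 expr1n.
apply: contrapT => H.
(* by homogeneity, the negation bounds [V - z] from below on all vectors *)
have lb x : delta * rnorm x <= rnorm (V x - z *: x).
  have [->|x0] := eqVneq x 0.
    by rewrite rnorm0 mulr0 rnorm_ge0.
  rewrite leNgt; apply/negP => hlt; apply: H.
  have nx : 0 < rnorm x by rewrite rnorm_gt0.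
  exists ((real_complex R (rnorm x)^-1) *: x).
    by rewrite rnormZ rnorm_real ger0_norm ?invr_ge0 ?rnorm_ge0// mulVf// gt_eqF.
  rewrite linearZ /= scalerA [z * _]mulrC -scalerA -scalerBr rnormZ rnorm_real.
  rewrite ger0_norm ?invr_ge0 ?rnorm_ge0// mulrC ler_pdivrMr// ltW//.
pose N := (Num.trunc ((2 * rnorm xi / delta) ^+ 2 / rnorm xi ^+ 2 + 1)).+1.
pose w (j : nat) := \sum_(k < N) (z^*) ^+ k *: iter k V (iter j U xi).
have wle j : rnorm (w j) <= 2 * rnorm xi / delta.
  have nj m y : rnorm (iter m V y) = rnorm y.
    by apply: (rnorm_isometry (T := iter m V)); apply: ip_iter; exact: ipV.
  have nu : rnorm (iter j U xi) = rnorm xi.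
    by apply: (rnorm_isometry (T := iter j U)); apply: ip_iter; exact: ipU.
  rewrite ler_pdivlMr// mulrC (le_trans (lb _))// telescope_eigen// rnormZ nz mul1r.
  by rewrite (le_trans (rnormB _ _))// rnormZ rnormX rnorm_conj nz expr1n mul1r nj nu; lra.
pose g k l := ipF (iter k V xi) (iter l V xi).
pose t k l := (q^*) ^+ k * q ^+ l.
have gram J : \sum_(j < J) ipF (w j) (w j) =
    \sum_(k < N) \sum_(l < N)
      ((z^*) ^+ k * z ^+ l * \sum_(j < J) t k l ^+ j) *: g k l.
  transitivity (\sum_(j < J) \sum_(k < N) \sum_(l < N)
     ((z^*) ^+ k * z ^+ l * t k l ^+ j) *: g k l).
    apply: eq_bigr => j _; rewrite ip_suml; apply: eq_bigr => k _.
    rewrite ip_sumr; apply: eq_bigr => l _.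
    by rewrite ipZl ipZr ip_iterVU conjX !scalerA mulrA.
  rewrite exchange_big; apply: eq_bigr => k _ /=.
  rewrite exchange_big; apply: eq_bigr => l _ /=.
  by rewrite mulr_sumr scaler_suml.
pose D := \sum_(k < N) \sum_(l < N | l != k) 2 / rnorm (t k l - 1) * rnorm xi ^+ 2.
have D0 : 0 <= D.
  apply: sumr_ge0 => k _; apply: sumr_ge0 => l _.
  by rewrite mulr_ge0 ?sqr_ge0// divr_ge0// rnorm_ge0.
have diag J : N%:R * J%:R * rnorm xi ^+ 2 <= J%:R * (2 * rnorm xi / delta) ^+ 2 + D.
  pose E := \sum_(k < N) \sum_(l < N | l != k)
      ((z^*) ^+ k * z ^+ l * \sum_(j < J) t k l ^+ j) *: g k l.
  have ED : rnorm E <= D.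
    apply: le_trans (rnorm_sum _ _ _) _; apply: ler_sum => k _.
    apply: le_trans (rnorm_sum _ _ _) _; apply: ler_sum => l lk.
    rewrite rnormZ !rnormM !rnormX rnorm_conj nz !expr1n !mul1r.
    rewrite ler_pM ?rnorm_ge0//.
      apply: rnorm_geom_le; last by apply: qconjX_neq1; rewrite eq_sym.
      by rewrite /t rnormM !rnormX rnorm_conj rnorm_cexp2pi !expr1n mulr1.
    apply: le_trans (rnorm_ip_le _ _ _) _.
    have nj m y : rnorm (iter m V y) = rnorm y.
      by apply: (rnorm_isometry (T := iter m V)); apply: ip_iter; exact: ipV.
    by rewrite !nj expr2.
  have split : \sum_(j < J) ipF (w j) (w j) = (N%:R * J%:R : R[i]) *: ipF xi xi + E.
    rewrite gram /E.
    have -> : (N%:R * J%:R : R[i]) *: ipF xi xi = \sum_(k < N) (J%:R : R[i]) *: ipF xi xi.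
      by rewrite sumr_const card_ord -[RHS]scaler_nat scalerA.
    rewrite -big_split /=; apply: eq_bigr => k _.
    rewrite (bigD1 k) //=; congr (_ + _).
    rewrite -exprMn z1 expr1n mul1r /t -exprMn q_conj expr1n /g ip_iter; last exact: ipV.
    congr (_ *: _); rewrite (eq_bigr (fun=> 1)) ?sumr_const ?card_ord// => j _.
    by rewrite expr1n.
  have -> : N%:R * J%:R * rnorm xi ^+ 2 = rnorm ((N%:R * J%:R : R[i]) *: ipF xi xi).
    by rewrite rnormZ rnorm_ip rnormM !rnorm_nat.
  have -> : (N%:R * J%:R : R[i]) *: ipF xi xi = \sum_(j < J) ipF (w j) (w j) - E.
    by rewrite split addrK.
  apply: le_trans (rnormB _ _) _; apply: lerD => //.
  apply: le_trans (rnorm_sum _ _ _) _.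
  rewrite -[J in J%:R]card_ord mulr_natl -sumr_const; apply: ler_sum => j _.
  by rewrite rnorm_ip ler_sqr ?nnegrE ?rnorm_ge0// (le_trans (rnorm_ge0 _) (wle j)).
have x2 : 0 < rnorm xi ^+ 2 by rewrite exprn_gt0// rnorm_gt0.
have NB : (2 * rnorm xi / delta) ^+ 2 + rnorm xi ^+ 2 <= N%:R * rnorm xi ^+ 2.
  rewrite -ler_pdivrMr// mulrDl divff ?gt_eqF//.
  exact: ltW (truncnS_gt _).
(* [D] does not depend on [J], so that a long average contradicts [diag] *)
pose J := (Num.trunc (D / rnorm xi ^+ 2)).+1.
have JD : D < J%:R * rnorm xi ^+ 2.
  by rewrite -ltr_pdivrMr// truncnS_gt.
have J0 : 0 < J%:R :> R by rewrite ltr0n.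
have := diag J; nra.
Qed.

Lemma rVUi j x : V (iter j Ui x) = q ^+ j *: iter j Ui (V x).
Proof.
have step y : V (Ui y) = q *: Ui (V y).
  by apply: (can_inj (rUK F)); rewrite rUV linearZ /= !rUiK.
elim: j => [|j IH] /=; first by rewrite expr0 scale1r.
by rewrite step IH linearZ /= scalerA exprS.
Qed.

Lemma ipUi x y : ipF (Ui x) (Ui y) = ipF x y.
Proof. by rewrite -(ipU F) !rUiK. Qed.

Lemma rnorm_iterUi j x : rnorm (iter j Ui x) = rnorm x.
Proof.
by apply: (rnorm_isometry (T := iter j Ui)); apply: ip_iter; exact: ipUi.
Qed.

Lemma rnorm_rV x : rnorm (V x) = rnorm x.
Proof. by apply: (rnorm_isometry (T := V)); exact: ipV. Qed.

Lemma iterUi_eigen z delta j x : rnorm (V x - z *: x) <= delta ->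
  rnorm (V (iter j Ui x) - (z * q ^+ j) *: iter j Ui x) <= delta.
Proof.
have lin y a b : iter j Ui (a - b *: y) = iter j Ui a - b *: iter j Ui y.
  by elim: j => [//|j IH] /=; rewrite IH linearB linearZ.
move=> h; rewrite rVUi mulrC -scalerA -scalerBr rnormZ rnormX rnorm_cexp2pi.
by rewrite expr1n mul1r -lin rnorm_iterUi.
Qed.

Lemma rVi_eigen z delta x : rnorm z = 1 ->
  rnorm (V x - z *: x) <= delta -> rnorm (Vi x - z^* *: x) <= delta.
Proof.
move=> z1; rewrite -[leLHS]rnormN opprB.
have -> : rnorm (z *: x - V x) = rnorm (V (Vi x - z^* *: x)).
  rewrite linearB linearZ /= rViK.
  have -> : x - z^* *: V x = z^* *: (z *: x - V x).
    by rewrite scalerBr scalerA conj_unit// scale1r.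
  by rewrite rnormZ rnorm_conj z1 mul1r.
by rewrite rnorm_rV.
Qed.

(** An isometry pairs eigenvectors for different eigenvalues to zero; for
    approximate eigenvectors the pairing is small. *)
Lemma approx_eigen_orthogonal (mu nu : R[i]) (delta : R) x y :
  rnorm mu = 1 -> rnorm x = 1 -> rnorm y = 1 ->
  rnorm (V x - mu *: x) <= delta -> rnorm (V y - nu *: y) <= delta ->
  rnorm (mu * nu^* - 1) * rnorm (ipF x y) <= 2 * delta.
Proof.
move=> mu1 x1 y1 hx hy.
rewrite -rnormZ scalerBl scale1r.
have -> : (mu * nu^*) *: ipF x y - ipF x y =
    - (ipF (V x - mu *: x) (V y) + mu *: ipF x (V y - nu *: y)).
  have e a b c : ipF (a - b) c = ipF a c - ipF b c.
    by rewrite -scaleN1r ipDl ipZl scaleN1r.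
  have e' a b c : ipF c (a - b) = ipF c a - ipF c b.
    by rewrite -scaleN1r ipDr ipZr rmorphN1 scaleN1r.
  by rewrite e e' ipV ipZl ipZr scalerBr scalerA subrKA opprB.
rewrite rnormN (le_trans (rnormD _ _))// mulr2n mulrDl mul1r lerD//.
  by rewrite (le_trans (rnorm_ip_le _ _ _))// rnorm_rV y1 mulr1.
by rewrite rnormZ mu1 mul1r (le_trans (rnorm_ip_le _ _ _))// x1 mul1r.
Qed.

Lemma qX_gap W : exists2 m : R, 0 < m <= 1 &
  forall k, (0 < k <= W)%N -> m <= rnorm (q ^+ k - 1).
Proof.
elim: W => [|W [m /andP[m0 m1] hm]].
  by exists 1; rewrite ?ltr01 ?lexx// => -[|k].
exists (Num.min m (rnorm (q ^+ W.+1 - 1))).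
  rewrite lt_min m0 rnorm_gt0 subr_eq0 cexp2pi_irrational_neq1//=.
  by rewrite ge_min m1.
move=> k /andP[k0]; rewrite leq_eqVlt ltnS => /orP[/eqP ->|kW].
  by rewrite ge_min lexx orbT.
by rewrite ge_min hm// k0.
Qed.

(** The off-diagonal gap [m] is uniform over the finite window, so an approximate
    eigenvector of precision [eta m / 2] makes its translates orthogonal up to
    [eta]. *)
Lemma approx_basis z W (eta : R) (xi : X) : rnorm z = 1 -> 0 < eta -> xi != 0 ->
  exists x, [/\ rnorm x = 1, rnorm (V x - z *: x) <= eta &
    forall j k, (j <= W)%N -> (k <= W)%N -> j != k ->
      rnorm (ipF (iter j Ui x) (iter k Ui x)) <= eta].
Proof.
move=> z1 e0 xi0; have [m /andP[m0 m1] hm] := qX_gap W.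
have [|x x1 hx] := approx_eigenvector
  (delta := eta * m / 2) (conj_unit z1) _ xi0.
  by rewrite divr_gt0 ?mulr_gt0.
exists x; split=> //; first by apply: le_trans hx _; nra.
have main j : (0 < j <= W)%N -> rnorm (ipF (iter j Ui x) x) <= eta /\
    rnorm (ipF x (iter j Ui x)) <= eta.
  move=> jW; have hj := hm j jW.
  have mu1 : rnorm (z * q ^+ j) = 1.
    by rewrite rnormM z1 rnormX rnorm_cexp2pi expr1n mul1r.
  have ej := iterUi_eigen j hx.
  have nj : rnorm (iter j Ui x) = 1 by rewrite rnorm_iterUi.
  have gap : rnorm (z * q ^+ j * z^* - 1) = rnorm (q ^+ j - 1).
    by rewrite mulrAC [z * _]mulrC conj_unit// mul1r.
  have gap' : rnorm (z * (z * q ^+ j)^* - 1) = rnorm (q ^+ j - 1).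
    rewrite -gap -[RHS]rnorm_conj; congr rnorm.
    by rewrite [RHS]rmorphB /= conjC1 [in RHS]rmorphM /= conjCK mulrC.
  have h1 := approx_eigen_orthogonal mu1 nj x1 ej hx.
  have h2 := approx_eigen_orthogonal z1 x1 nj hx ej.
  rewrite gap in h1; rewrite gap' in h2.
  split.
  - rewrite -(ler_pM2l m0); apply: le_trans (ler_wpM2r (rnorm_ge0 _) hj) _.
    by apply: le_trans h1 _; lra.
  - rewrite -(ler_pM2l m0); apply: le_trans (ler_wpM2r (rnorm_ge0 _) hj) _.
    by apply: le_trans h2 _; lra.
move=> j k jW kW; case: (ltngtP j k) => // jk _.
- rewrite -(subnK (ltnW jk)) addnC iterD ip_iter; last exact: ipUi.
  by have [] := main (k - j)%N; rewrite // subn_gt0 jk (leq_trans (leq_subr _ _)).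
- rewrite -(subnK (ltnW jk)) addnC iterD ip_iter; last exact: ipUi.
  by have [] := main (j - k)%N; rewrite // subn_gt0 jk (leq_trans (leq_subr _ _)).
Qed.

Lemma rnorm_almost_orthonormal N (c : 'I_N -> R[i]) (e : 'I_N -> X) p (eta : R) :
  0 <= eta -> rnorm p = 1 -> (forall j, ipF (e j) (e j) = p) ->
  (forall j k, j != k -> rnorm (ipF (e j) (e k)) <= eta) ->
  `|rnorm (\sum_j c j *: e j) ^+ 2 - \sum_j rnorm (c j) ^+ 2|
    <= (\sum_j rnorm (c j)) ^+ 2 * eta.
Proof.
move=> eta0 p1 ep he.
pose E := \sum_j \sum_(k | k != j) (c j * (c k)^*) *: ipF (e j) (e k).
have S0 : 0 <= \sum_j rnorm (c j) ^+ 2 by apply: sumr_ge0 => j _; exact: sqr_ge0.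
have ipE : ipF (\sum_j c j *: e j) (\sum_j c j *: e j) =
    (real_complex R (\sum_j rnorm (c j) ^+ 2)) *: p + E.
  rewrite ip_suml rmorph_sum /= scaler_suml -big_split /=; apply: eq_bigr => j _.
  rewrite ip_sumr (bigD1 j)//=; congr (_ + _).
    by rewrite ipZl ipZr scalerA ep rmorphXn /= rnormE normCK.
  by apply: eq_bigr => k _; rewrite ipZl ipZr scalerA.
have ED : rnorm E <= (\sum_j rnorm (c j)) ^+ 2 * eta.
  apply: (@le_trans _ _ (\sum_j \sum_(k | k != j) rnorm (c j) * rnorm (c k) * eta)).
    apply: le_trans (rnorm_sum _ _ _) _; apply: ler_sum => j _.
    apply: le_trans (rnorm_sum _ _ _) _; apply: ler_sum => k kj.
    by rewrite rnormZ rnormM rnorm_conj ler_wpM2l ?mulr_ge0 ?rnorm_ge0// he// eq_sym.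
  rewrite expr2 mulr_suml mulr_suml; apply: ler_sum => j _.
  rewrite mulr_sumr mulr_suml [leRHS](bigD1 j)//= ler_wpDl//.
  by rewrite !mulr_ge0 ?rnorm_ge0.
rewrite -(rnorm_ip F) ipE ler_norml; apply/andP; split.
- have := rnormB ((real_complex R (\sum_j rnorm (c j) ^+ 2)) *: p + E) E.
  by rewrite addrK rnormZ p1 mulr1 rnorm_real ger0_norm//; lra.
- have := rnormD ((real_complex R (\sum_j rnorm (c j) ^+ 2)) *: p) E.
  by rewrite rnormZ p1 mulr1 rnorm_real ger0_norm//; lra.
Qed.

Definition frame_op (a1 am1 b1 bm1 : R[i]) x : X :=
  a1 *: U x + am1 *: Ui x + b1 *: V x + bm1 *: Vi x.

Section Shift.
Variables (W : nat) (c : nat -> R[i]) (x : X).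
Hypotheses (c0 : c 0 = 0) (cW : forall j, (W <= j)%N -> c j = 0).

Lemma sum_rU : U (\sum_(j < W.+1) c j *: iter j Ui x) =
  \sum_(j < W.+1) c j.+1 *: iter j Ui x.
Proof.
rewrite linear_sum big_ord_recl c0 scale0r linear0 add0r.
rewrite [RHS]big_ord_recr /= cW// scale0r addr0.
by apply: eq_bigr => j _; rewrite linearZ /= rUiK.
Qed.

Lemma sum_rUi : Ui (\sum_(j < W.+1) c j *: iter j Ui x) =
  \sum_(j < W.+1) c j.-1 *: iter j Ui x.
Proof.
rewrite linear_sum big_ord_recr /= cW// scale0r linear0 addr0.
rewrite [RHS]big_ord_recl /= c0 scale0r add0r.
by apply: eq_bigr => j _; rewrite linearZ.
Qed.

End Shift.

Lemma row_defect (a1 am1 b1 bm1 lam cj c1 cm m m' : R[i]) (e v v' : X) :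
  lam *: (cj *: e) -
    (a1 *: (c1 *: e) + am1 *: (cm *: e) + b1 *: (cj *: v) + bm1 *: (cj *: v')) =
  (lam * cj - (a1 * c1 + am1 * cm + (b1 * m + bm1 * m') * cj)) *: e -
    cj *: (b1 *: (v - m *: e) + bm1 *: (v' - m' *: e)).
Proof.
have -> : cj *: (b1 *: (v - m *: e) + bm1 *: (v' - m' *: e)) =
    (b1 *: (cj *: v) + bm1 *: (cj *: v')) - ((b1 * m + bm1 * m') * cj) *: e.
  rewrite !scalerBr scalerDr !scalerBr !scalerA addrACA -opprD -scalerDl.
  by congr (_ *: _ + _ *: _ - _ *: _); ring.
rewrite opprB addrA -scalerDl !scalerA -[_ + _ + _ + _]addrA opprD addrA.
by rewrite -scalerDl -scalerBl; congr (_ *: _ - _); ring.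
Qed.

(** The vectors [U^-j x] of [approx_basis] turn [frame_op] into [lattice_op] with
    potential [z q^j], up to errors proportional to the precision [eta]; these
    vanish in the limit, the sequence [c] being fixed. *)
Lemma lower_bound_transfer (a1 am1 b1 bm1 lam z : R[i]) (kappa : R) W
    (c : nat -> R[i]) (xi : X) :
  xi != 0 -> rnorm z = 1 -> 0 <= kappa -> c 0 = 0 ->
  (forall j, (W <= j)%N -> c j = 0) ->
  (forall y, kappa * rnorm y <= rnorm (lam *: y - frame_op a1 am1 b1 bm1 y)) ->
  kappa ^+ 2 * (\sum_(j < W.+1) rnorm (c j) ^+ 2) <=
  \sum_(j < W.+1)
    rnorm (lam * c j - lattice_op a1 am1 b1 bm1 (fun j => z * q ^+ j) c j) ^+ 2.
Proof.
move=> xi0 z1 k0 c0 cW lb.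
pose mu j := z * q ^+ j.
have mu1 j : rnorm (mu j) = 1.
  by rewrite rnormM z1 rnormX rnorm_cexp2pi expr1n mul1r.
pose d j := lam * c j - lattice_op a1 am1 b1 bm1 mu c j.
pose A := \sum_(j < W.+1) rnorm (c j).
pose B := \sum_(j < W.+1) rnorm (d j).
pose b := rnorm b1 + rnorm bm1.
have A0 : 0 <= A by apply: sumr_ge0 => j _; exact: rnorm_ge0.
have B0 : 0 <= B by apply: sumr_ge0 => j _; exact: rnorm_ge0.
have b0 : 0 <= b by rewrite addr_ge0 ?rnorm_ge0.
rewrite -/mu -[leRHS]/(\sum_(j < W.+1) rnorm (d j) ^+ 2).
set C2 := \sum_(j < _) rnorm (c j) ^+ 2; set D2 := \sum_(j < _) _.
pose K := kappa ^+ 2 * A ^+ 2 + B ^+ 2 + 2 * B * (A * b) + (A * b) ^+ 2.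
have K0 : 0 <= K.
  by rewrite !addr_ge0 ?mulr_ge0 ?sqr_ge0.
suff main eta : 0 < eta <= 1 -> kappa ^+ 2 * C2 <= D2 + eta * K.
  apply/ler_addgt0Pr => e e0.
  pose eta := Num.min 1 (e / (K + 1)).
  have K1 : 0 < K + 1 by rewrite ltr_wpDl.
  have eta0 : 0 < eta by rewrite lt_min ltr01 divr_gt0.
  apply: le_trans (main eta _) _; first by rewrite eta0 ge_min lexx.
  rewrite lerD2l; have : eta <= e / (K + 1) by rewrite ge_min lexx orbT.
  by rewrite ler_pdivlMr// => h; nra.
move=> /andP[eta0 eta1].
have [x [x1 hx ho]] := approx_basis W z1 eta0 xi0.
pose e j := iter j Ui x.
have ee (j : nat) : ipF (e j) (e j) = ipF x x by rewrite ip_iter//; exact: ipUi.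
have p1 : rnorm (ipF x x) = 1 by rewrite rnorm_ip x1 expr1n.
have on (g : nat -> R[i]) : `|rnorm (\sum_(j < W.+1) g j *: e j) ^+ 2 -
    \sum_(j < W.+1) rnorm (g j) ^+ 2| <= (\sum_(j < W.+1) rnorm (g j)) ^+ 2 * eta.
  apply: (rnorm_almost_orthonormal _ (ltW eta0) p1) => [j|j k jk]; first exact: ee.
  by apply: ho => //; rewrite -ltnS.
have e1 j : rnorm (e j) = 1 by rewrite rnorm_iterUi.
pose y := \sum_(j < W.+1) c j *: e j.
pose Dv := \sum_(j < W.+1) d j *: e j.
pose err := \sum_(j < W.+1)
  c j *: (b1 *: (V (e j) - mu j *: e j) + bm1 *: (Vi (e j) - (mu j)^* *: e j)).
have res : lam *: y - frame_op a1 am1 b1 bm1 y = Dv - err.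
  rewrite /frame_op /y sum_rU// sum_rUi// [V _]linear_sum [Vi _]linear_sum /= !scaler_sumr.
  rewrite /Dv /err -!big_split /= -!sumrB; apply: eq_bigr => j _.
  by rewrite [V (_ *: _)]linearZ [Vi (_ *: _)]linearZ /=; exact: row_defect.
have errle : rnorm err <= A * b * eta.
  apply: le_trans (rnorm_sum _ _ _) _; rewrite !mulr_suml; apply: ler_sum => j _.
  rewrite rnormZ -mulrA ler_wpM2l ?rnorm_ge0//.
  apply: le_trans (rnormD _ _) _; rewrite !rnormZ mulrDl.
  have he := iterUi_eigen j hx.
  by rewrite lerD// ler_wpM2l ?rnorm_ge0//; exact: rVi_eigen.
have DvB : rnorm Dv <= B.
  apply: le_trans (rnorm_sum _ _ _) _; apply: ler_sum => j _.
  by rewrite rnormZ e1 mulr1.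
have := on c; rewrite -/y -/C2 -/A ler_norml => /andP[hy _].
have := on d; rewrite -/Dv -/D2 -/B ler_norml => /andP[_ hD].
have hl := lb y; rewrite res in hl.
have hl2 : kappa ^+ 2 * rnorm y ^+ 2 <= (rnorm Dv + A * b * eta) ^+ 2.
  have t0 : 0 <= rnorm Dv + A * b * eta.
    by rewrite addr_ge0 ?rnorm_ge0// !mulr_ge0// ltW.
  rewrite -exprMn ler_sqr ?nnegrE ?mulr_ge0 ?rnorm_ge0//.
  by apply: le_trans hl _; apply: le_trans (rnormB _ _) _; rewrite lerD2l.
have k2 : 0 <= kappa ^+ 2 by exact: sqr_ge0.
have h1 : kappa ^+ 2 * C2 <= kappa ^+ 2 * rnorm y ^+ 2 + kappa ^+ 2 * (A ^+ 2 * eta).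
  by rewrite -mulrDr ler_wpM2l//; lra.
apply: le_trans h1 _; apply: le_trans (lerD hl2 (lexx _)) _.
have Ab0 : 0 <= A * b by rewrite mulr_ge0.
have h2 : rnorm Dv * (A * b * eta) <= B * (A * b * eta).
  by rewrite ler_wpM2r// mulr_ge0// ltW.
have h3 : (A * b) ^+ 2 * eta ^+ 2 <= (A * b) ^+ 2 * eta.
  by rewrite ler_wpM2l ?sqr_ge0//; nra.
rewrite /K; move: h2 h3 hD; set u := A * b; set r := rnorm Dv => h2 h3 hD.
have -> : (r + u * eta) ^+ 2 = r ^+ 2 + 2 * (r * (u * eta)) + u ^+ 2 * eta ^+ 2 by ring.
lra.
Qed.

End Frame.

(** * Localization on windows of the cycle *)

Definition tent (L j : nat) : nat := minn j (2 * L - j).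

Lemma tent_lipS L j : (tent L j.+1 <= tent L j + 1 /\ tent L j <= tent L j.+1 + 1)%N.
Proof. by rewrite /tent; split; lia. Qed.

Lemma tent_sqr_sum L : (L ^ 3 <= 3 * \sum_(j < (2 * L).+1) tent L j ^ 2)%N.
Proof.
have cube m : (m ^ 3 <= 3 * \sum_(j < m.+1) j ^ 2)%N.
  elim: m => [|m IH]; first by [].
  have e3 : (m.+1 ^ 3 = m ^ 3 + 3 * m ^ 2 + 3 * m + 1)%N by ring.
  have e2 : (m.+1 ^ 2 = m ^ 2 + 2 * m + 1)%N by ring.
  rewrite big_ord_recr /= mulnDr e3 e2. move: IH.
  by set S := bigop.body _ _ _; lia.
apply: leq_trans (cube L) _; rewrite leq_mul2l /=.
rewrite -(big_mkord xpredT (fun j => j ^ 2)%N).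
rewrite -(big_mkord xpredT (fun j => tent L j ^ 2)%N).
have h : (L.+1 <= (2 * L).+1)%N by lia.
rewrite [leqRHS](big_cat_nat (leq0n _) h)//=; apply: leq_trans (leq_addr _ _).
rewrite leq_eqVlt; apply/orP; left; apply/eqP; apply: eq_big_nat => j jL.
by rewrite /tent; congr (_ ^ 2)%N; lia.
Qed.

Section Localization.
Variable R : realType.
Implicit Types (f : nat -> R).

Lemma sum_periodic n f m : (forall k, f (k + n)%N = f k) ->
  \sum_(s < n) f (s + m)%N = \sum_(s < n) f s.
Proof.
move=> per; elim: m => [|m IH]; first by apply: eq_bigr => s _; rewrite addn0.
rewrite -IH; case: n per {IH} => [|n] per; first by rewrite !big_ord0.
rewrite big_ord_recr big_ord_recl /= addrC; congr (_ + _).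
  by rewrite addnS -addSn addnC per.
by apply: eq_bigr => s _; rewrite /bump /= addnS.
Qed.

(** Cauchy-Schwarz with weights [eps] and [M K]; written without dividing by [M],
    which may vanish. *)
Lemma sqr_weighted_le (a b eps M K : R) : 0 < eps -> 0 < K -> 0 <= M ->
  (a + M * b) ^+ 2 <= (eps + M * K) * (a ^+ 2 / eps + M * (b ^+ 2 / K)).
Proof.
move=> e0 K0 M0.
rewrite -subr_ge0.
have -> : (eps + M * K) * (a ^+ 2 / eps + M * (b ^+ 2 / K)) - (a + M * b) ^+ 2
   = M / (eps * K) * (a * K - b * eps) ^+ 2.
  by field; rewrite !gt_eqF.
by rewrite mulr_ge0 ?sqr_ge0// divr_ge0// ltW// mulr_gt0.
Qed.

Lemma sqr_add3_le (a b c : R) : (a + b + c) ^+ 2 <= 3 * (a ^+ 2 + b ^+ 2 + c ^+ 2).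
Proof.
have := sqr_ge0 (a - b); have := sqr_ge0 (b - c); have := sqr_ge0 (a - c).
by nra.
Qed.


(** Here [X] is the periodic extension of an approximate eigenvector of the cyclic
    operator, with residual [r]; it is cut to the window of indices [0 .. W]
    starting at [s].  The hypothesis [lb] is the lower bound for the operators on
    windows, with arbitrary phase [z]; [E] bounds the phase error on a window and
    [K] the relative size of all the errors. *)
Section Window.
Variables (theta eps M K E kappa : R) (n p L : nat) (X : nat -> R[i]).
Variables (a1 am1 b1 bm1 lam : R[i]).
Hypotheses (e0 : 0 < eps) (M0 : 0 <= M) (K0 : 0 < K) (kappa0 : 0 <= kappa).
Hypotheses (aM : rnorm a1 <= M) (amM : rnorm am1 <= M)
  (bM : rnorm b1 <= M) (bmM : rnorm bm1 <= M).
Hypotheses (n0 : (0 < n)%N) (Xper : forall k, X (k + n)%N = X k).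
Let om := cexp2pi (p%:R / n%:R : R).
Let q := cexp2pi theta.
Let S := \sum_(k < n) rnorm (X k) ^+ 2.
Let W := (2 * L)%N.
Let g j : R := (tent L j)%:R.
Let G := \sum_(j < W.+1) g j ^+ 2.
Let r k := lam * X k - lattice_op a1 am1 b1 bm1 (fun k => om ^+ k) X k.
Hypotheses (hE : `|theta - p%:R / n%:R| * (2 * pi * L%:R) <= E).
Hypotheses (hK : 3 * (2 * W.+1%:R + 4 * E ^+ 2 * G) <= K ^+ 2 * G).
Hypotheses (S0 : 0 < S) (G0 : 0 < G).
Hypothesis hr : \sum_(k < n) rnorm (r k.+1) ^+ 2 <= eps ^+ 2 * S.
Hypothesis lb : forall (c : nat -> R[i]) z, rnorm z = 1 -> c 0 = 0 ->
  (forall j, (W <= j)%N -> c j = 0) ->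
  kappa ^+ 2 * (\sum_(j < W.+1) rnorm (c j) ^+ 2) <=
  \sum_(j < W.+1)
    rnorm (lam * c j - lattice_op a1 am1 b1 bm1 (fun j => z * q ^+ j) c j) ^+ 2.

Let om_period : om ^+ n = 1.
Proof.
rewrite -cexp2piMn mulrCA divff ?mulr1 ?cexp2pi_nat//.
by rewrite pnatr_eq0 -lt0n.
Qed.

Let r_period k : r (k.+1 + n)%N = r k.+1.
Proof.
have omp m : om ^+ (m + n) = om ^+ m by rewrite exprD om_period mulr1.
by rewrite /r /lattice_op addSn /= -!addSn !Xper omp.
Qed.

(* the phase of the window starting at [s], matched at its centre [s + L] *)
Let z s := cexp2pi ((s + L)%:R * (p%:R / n%:R) - L%:R * theta : R).

Let phase_close s j : (j <= W)%N -> rnorm (z s * q ^+ j - om ^+ (s + j)) <= E.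
Proof.
move=> jW; rewrite /z /q /om -!cexp2piMn -cexp2piD.
apply: le_trans (rnorm_cexp2piB _ _) _; apply: le_trans hE.
have -> : (s + L)%:R * (p%:R / n%:R) - L%:R * theta + j%:R * theta -
    (s + j)%:R * (p%:R / n%:R) = (theta - p%:R / n%:R) * (j%:R - L%:R) :> R.
  by rewrite !natrD; ring.
rewrite normrM mulrCA ler_wpM2l// ler_wpM2l ?mulr_ge0 ?pi_ge0//.
have : (j%:R : R) <= 2 * L%:R by rewrite -natrM ler_nat.
have : 0 <= (j%:R : R) by [].
by rewrite ler_norml => h1 h2; apply/andP; split; lra.
Qed.

Let c s j := real_complex R (g j) * X (s + j)%N.
Let defect s j := rnorm (X (s + j).+1) + rnorm (X (s + j).-1) +
  2 * E * (g j * rnorm (X (s + j)%N)).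

Let g_step j : `|g j.+1 - g j| <= 1.
Proof.
have [] := tent_lipS L j; rewrite -!(ler_nat R) !natrD -/(g j) -/(g j.+1) => h1 h2.
by rewrite ler_norml; apply/andP; split; lra.
Qed.

Let g_stepN j : `|g j.-1 - g j| <= 1.
Proof. by case: j => [|j] /=; rewrite ?subrr ?normr0// distrC. Qed.

Let g0 : g 0 = 0. Proof. by rewrite /g /tent min0n. Qed.
Let g_ge0 j : 0 <= g j. Proof. exact: ler0n. Qed.

(* The commutator of the operator with the tent, which has slope at most one,
   involves only the values of [X] at the neighbours; the rest is phase error. *)
Let d_le s j : (j <= W)%N ->
  rnorm (lam * c s.+1 j - lattice_op a1 am1 b1 bm1 (fun j => z s.+1 * q ^+ j) (c s.+1) j)
    <= g j * rnorm (r (s.+1 + j)) + M * defect s.+1 j.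
Proof.
move=> jW; set mu := fun j => _; set w := om ^+ (s.+1 + j).
have cm : c s.+1 j.-1 = real_complex R (g j.-1) * X (s.+1 + j).-1.
  by case: j {jW w} => [|j] /=; rewrite /c ?g0 ?mul0r// addnS.
have -> : lam * c s.+1 j - lattice_op a1 am1 b1 bm1 mu (c s.+1) j =
    real_complex R (g j) * r (s.+1 + j) -
    (a1 * (real_complex R (g j.+1 - g j) * X (s.+1 + j).+1) +
     am1 * (real_complex R (g j.-1 - g j) * X (s.+1 + j).-1) +
     (b1 * (mu j - w) + bm1 * (mu j - w)^*) * (real_complex R (g j) * X (s.+1 + j)%N)).
  rewrite /lattice_op cm /r /lattice_op -/w /c addnS.
  rewrite !rmorphB /=.
  ring.
apply: le_trans (rnormB _ _) _; rewrite rnormM rnorm_real ger0_norm// lerD2l.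
have mw : rnorm (mu j - w) <= E by exact: phase_close.
have E0 : 0 <= E by apply: le_trans (rnorm_ge0 _) mw.
rewrite /defect [M * (_ + _)]mulrDr [M * (_ + _)]mulrDr.
apply: le_trans (rnormD _ _) _; apply: lerD.
  apply: le_trans (rnormD _ _) _; apply: lerD; rewrite rnormM.
    apply: ler_pM; rewrite ?rnorm_ge0// rnormM rnorm_real.
    by rewrite ler_piMl ?rnorm_ge0.
  apply: ler_pM; rewrite ?rnorm_ge0// rnormM rnorm_real.
  by rewrite ler_piMl ?rnorm_ge0.
rewrite rnormM [M * _]mulrA; apply: ler_pM; rewrite ?rnorm_ge0//.
  apply: le_trans (rnormD _ _) _; rewrite !rnormM rnorm_conj.
  have := ler_pM (rnorm_ge0 _) (rnorm_ge0 _) bM mw.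
  have := ler_pM (rnorm_ge0 _) (rnorm_ge0 _) bmM mw.
  by move=> h1 h2; lra.
by rewrite rnormM rnorm_real ger0_norm.
Qed.

Let Xshift m : \sum_(s < n) rnorm (X (s + m)) ^+ 2 = S.
Proof. by rewrite (sum_periodic (f := fun k => rnorm (X k) ^+ 2))// => k; rewrite Xper. Qed.

Let defect_sum j : \sum_(s < n) defect s.+1 j ^+ 2 <= 3 * (2 * S + 4 * E ^+ 2 * g j ^+ 2 * S).
Proof.
have -> : 3 * (2 * S + 4 * E ^+ 2 * g j ^+ 2 * S) = \sum_(s < n)
   3 * (rnorm (X (s + j.+2)) ^+ 2 + rnorm (X (s + j)) ^+ 2 +
      4 * E ^+ 2 * g j ^+ 2 * rnorm (X (s + j.+1)) ^+ 2).
  rewrite -mulr_sumr !big_split /= -mulr_sumr !Xshift; ring.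
apply: ler_sum => s _; apply: le_trans (sqr_add3_le _ _ _) _.
by rewrite !addnS !addSn /= !exprMn; lra.
Qed.

(** Summing the lower bounds over all windows weighs each entry of [X] by the
    same total [G], which leaves a comparison of [kappa^2 G S] with
    [(eps + M K)^2 G S]. *)
Lemma localization : kappa <= eps + M * K.
Proof.
have eMK : 0 < eps + M * K by rewrite ltr_wpDr// mulr_ge0// ltW.
pose d s j := lam * c s j - lattice_op a1 am1 b1 bm1 (fun j => z s * q ^+ j) (c s) j.
have low : kappa ^+ 2 * (G * S) <= \sum_(s < n) \sum_(j < W.+1) rnorm (d s.+1 j) ^+ 2.
  have -> : kappa ^+ 2 * (G * S) =
      \sum_(s < n) kappa ^+ 2 * \sum_(j < W.+1) rnorm (c s.+1 j) ^+ 2.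
    rewrite -mulr_sumr exchange_big /=; congr (_ * _).
    rewrite mulr_suml; apply: eq_bigr => j _.
    rewrite -(Xshift j.+1) mulr_sumr; apply: eq_bigr => s _.
    by rewrite rnormM rnorm_real exprMn real_normK ?num_real// addnS addSn.
  apply: ler_sum => s _; apply: lb.
  - exact: rnorm_cexp2pi.
  - by rewrite /c g0 mul0r.
  - move=> j; rewrite /c /g /tent -/W -subn_eq0 => /eqP ->.
    by rewrite minn0 mul0r.
have up : \sum_(s < n) \sum_(j < W.+1) rnorm (d s.+1 j) ^+ 2 <=
    (eps + M * K) ^+ 2 * (G * S).
  apply: (@le_trans _ _ (\sum_(j < W.+1) (eps + M * K) *
     (g j ^+ 2 * (eps ^+ 2 * S) / eps +
      M * (3 * (2 * S + 4 * E ^+ 2 * g j ^+ 2 * S) / K)))).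
    rewrite exchange_big /=; apply: ler_sum => j _.
    apply: (@le_trans _ _ (\sum_(s < n) (eps + M * K) *
       ((g j * rnorm (r (s.+1 + j))) ^+ 2 / eps + M * (defect s.+1 j ^+ 2 / K)))).
      apply: ler_sum => s _; apply: le_trans (sqr_weighted_le _ _ e0 K0 M0).
      rewrite ler_sqr ?nnegrE ?rnorm_ge0//.
        by apply: d_le; rewrite -ltnS.
      apply: le_trans (rnorm_ge0 _) (d_le s _); exact: (ltn_ord j).
    rewrite -mulr_sumr ler_pM2l// big_split /=; apply: lerD.
      rewrite -mulr_suml ler_pM2r ?invr_gt0//.
      under eq_bigr do rewrite exprMn.
      rewrite -mulr_sumr ler_wpM2l ?sqr_ge0//.
      under eq_bigr do rewrite addSnnS addnC addSn addnC.
      have rper k : rnorm (r (k + n).+1) ^+ 2 = rnorm (r k.+1) ^+ 2.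
        by rewrite -addSn r_period.
      apply: le_trans hr; rewrite -(sum_periodic j rper) le_eqVlt; apply/orP; left.
      by apply/eqP; apply: eq_bigr => s _.
    by rewrite -mulr_sumr ler_wpM2l// -mulr_suml ler_pM2r ?invr_gt0//.
  rewrite -mulr_sumr [(_ + _) ^+ 2]expr2 -[leRHS]mulrA ler_pM2l// big_split /=.
  rewrite [leRHS]mulrDl; apply: lerD.
    rewrite -!mulr_suml -/G le_eqVlt; apply/orP; left; apply/eqP.
    by field; rewrite gt_eqF.
  rewrite -mulr_sumr -!mulrA ler_wpM2l// -mulr_suml ler_pdivrMr//.
  rewrite -mulr_sumr big_split /= sumr_const card_ord -mulr_suml -mulr_sumr -/G.
  have := ler_wpM2r (ltW S0) hK; by rewrite -[2 * S *+ _]mulr_natr; lra.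
have : kappa ^+ 2 <= (eps + M * K) ^+ 2.
  by rewrite -(ler_pM2r (mulr_gt0 G0 S0)); apply: le_trans low up.
by rewrite ler_sqr ?nnegrE// ltW.
Qed.

End Window.

End Localization.

(** * From matrices to periodic sequences *)

Section Matrices.
Variables (R : realType) (n' : nat).
Local Notation n := n'.+1.
Implicit Types (x : 'cV[R[i]]_n).
Local Open Scope sesquilinear_scope.

Definition periodize x (k : nat) : R[i] := x (inord (k %% n)) 0.

Lemma periodizeD x k : periodize x (k + n)%N = periodize x k.
Proof. by rewrite /periodize modnDr. Qed.

Lemma periodize_ord x (i : 'I_n) : periodize x i = x i 0.
Proof.
by rewrite /periodize modn_small ?ltn_ord//; congr (x _ _); apply: val_inj; rewrite /= inordK.
Qed.

Lemma val_inord_mod k : (inord (k %% n) : 'I_n) = (k %% n)%N :> nat.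
Proof. by rewrite inordK ?ltn_mod. Qed.

Lemma enorm_ge0 m (x : 'cV[R[i]]_m) : 0 <= enorm x.
Proof. exact: sqrtr_ge0. Qed.

Lemma sqr_enorm m (x : 'cV[R[i]]_m) : enorm x ^+ 2 = \sum_(i < m) rnorm (x i 0) ^+ 2.
Proof. by rewrite sqr_sqrtr// sumr_ge0// => i _; exact: sqr_ge0. Qed.

Lemma sqr_enorm_periodize x m :
  enorm x ^+ 2 = \sum_(k < n) rnorm (periodize x (k + m)) ^+ 2.
Proof.
rewrite (sum_periodic (f := fun k => rnorm (periodize x k) ^+ 2)) => [|k].
  by rewrite sqr_enorm; apply: eq_bigr => i _; rewrite periodize_ord.
by rewrite periodizeD.
Qed.

Lemma periodize_rotation_mx p (a1 am1 b1 bm1 : R[i]) x k :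
  periodize (rotation_mx n p a1 am1 b1 bm1 *m x) k.+1 =
  lattice_op a1 am1 b1 bm1 (fun j => cexp2pi (p%:R / n%:R) ^+ j) (periodize x) k.+1.
Proof.
set om := cexp2pi _; set i : 'I_n := inord (k.+1 %% n).
have iE : i = (k.+1 %% n)%N :> nat by exact: val_inord_mod.
have omn : om ^+ n = 1.
  by rewrite -cexp2piMn mulrCA divff ?mulr1 ?cexp2pi_nat// pnatr_eq0.
have Smod m : ((m %% n).+1 %% n = m.+1 %% n)%N by rewrite -addn1 modnDml addn1.
have shiftE : (shift_mx n *m x) i 0 = periodize x k.+2.
  rewrite mxE (bigD1 (inord (k.+2 %% n)))//= big1 ?addr0 => [|j jk].
    by rewrite mxE val_inord_mod iE Smod eqxx mul1r.
  rewrite mxE iE Smod.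
  case: eqP => [e|]; last by rewrite mul0r.
  by case/eqP: jk; apply: val_inj; rewrite /= inordK ?ltn_mod.
have shiftCE : ((shift_mx n)^t* *m x) i 0 = periodize x k.
  rewrite mxE (bigD1 (inord (k %% n)))//= big1 ?addr0 => [|j jk].
    rewrite !mxE val_inord_mod iE Smod eqxx.
    by rewrite rmorph1 mul1r.
  rewrite !mxE iE; case: eqP => [e|]; last by rewrite rmorph0 mul0r.
  case/eqP: jk; apply: val_inj; rewrite /= inordK ?ltn_mod//.
  move/eqP: e; rewrite -(addn1 k) -(addn1 j) eqn_modDr => /eqP ->.
  by rewrite modn_small.
have clockE : (clock_mx n p *m x) i 0 = om ^+ k.+1 * periodize x k.+1.
  by rewrite mul_diag_mx !mxE -/om iE expr_mod.
have clockCE : ((clock_mx n p)^t* *m x) i 0 = (om ^+ k.+1)^* * periodize x k.+1.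
  rewrite tr_diag_mx map_diag_mx mul_diag_mx !mxE -/om iE expr_mod//.
rewrite [LHS]/periodize -/i /rotation_mx !mulmxDl -!scalemxAl.
have e (A B : 'cV[R[i]]_n) : (A + B) i 0 = A i 0 + B i 0 by rewrite mxE.
have e' c (A : 'cV[R[i]]_n) : (c *: A) i 0 = c * A i 0 by rewrite mxE.
rewrite !e !e' shiftE shiftCE clockE clockCE /lattice_op /=; ring.
Qed.

End Matrices.

Lemma nat_sqrt_floor m : (0 < m)%N ->
  exists L, [/\ (0 < L)%N, (L ^ 2 <= m)%N & (m <= 4 * L ^ 2)%N].
Proof.
move=> m0.
have [L [h1 h2]] : exists L, (L ^ 2 <= m)%N /\ (m < L.+1 ^ 2)%N.
  elim: m {m0} => [|m [L [h1 h2]]]; first by exists 0%N.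
  have [h|h] := ltnP m.+1 (L.+1 ^ 2).
    by exists L; split=> //; apply: leq_trans h1 _.
  exists L.+1; split=> //; apply: leq_trans (_ : L.+1 ^ 2 < _)%N => //.
  by rewrite ltn_exp2r.
exists L; case: L h1 h2 => [|L] h1 h2; first by move: h2 m0; case: m {h1}.
split=> //; apply: leq_trans (ltnW h2) _.
by rewrite -[4%N]/(2 ^ 2)%N -expnMn leq_exp2r//; lia.
Qed.

Section Comparison.
Variables (R : realType) (theta : R) (X Y : normedModType R[i]).
Variable F : rotation_frame theta X Y.
Hypotheses (theta_gt0 : 0 < theta) (theta_irr : irrational theta).

(** Here [21^2 = 441] splits as [249 + 192]: the gradient of the tent uses
    [G >= L^3 / 3] and [n <= 4 L^2], the phase error uses [L^2 <= n] and
    [pi^2 <= 16]. *)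
Lemma tent_constants (n L : nat) : let l := L%:R : R in let N := n%:R : R in
  let G := \sum_(j < (2 * L).+1) (tent L j)%:R ^+ 2 : R in
  (0 < L)%N -> (L ^ 2 <= n)%N -> (n <= 4 * L ^ 2)%N ->
  0 < G /\
  3 * (2 * (2 * L).+1%:R + 4 * (pi * l / N) ^+ 2 * G) <= (21 / Num.sqrt N) ^+ 2 * G.
Proof.
move=> l N G L0 Ln nL.
have l1 : 1 <= l by rewrite ler1n.
have lN : l ^+ 2 <= N by rewrite -natrX ler_nat.
have Nl : N <= 4 * l ^+ 2 by rewrite -natrX -natrM ler_nat.
have Gl : l ^+ 3 <= 3 * G.
  rewrite /l /G -natrX.
  under [X in 3 * X]eq_bigr do rewrite -natrX.
  by rewrite -natr_sum -natrM ler_nat tent_sqr_sum.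
have l3 : 0 < l ^+ 3 by rewrite exprn_gt0// (lt_le_trans ltr01).
have G0 : 0 < G by lra.
split=> //.
have N0 : 0 < N by apply: lt_le_trans lN; rewrite exprn_gt0// (lt_le_trans ltr01).
have pi4 : pi ^+ 2 <= 16 :> R.
  have := pihalf_lt2 R; have := pi_ge0 R => h1 h2.
  have h3 : pi <= 4 :> R by lra.
  nra.
have -> : (21 / Num.sqrt N) ^+ 2 * G = 441 * G / N.
  by rewrite exprMn exprVn sqr_sqrtr ?ltW// -natrX mulrAC.
have h1 : 4 * (pi * l / N) ^+ 2 * G <= 64 * G / N.
  have -> : 4 * (pi * l / N) ^+ 2 * G = (pi ^+ 2 * l ^+ 2 / N) * (4 * G / N).
    by field; rewrite gt_eqF.
  have -> : 64 * G / N = 16 * (4 * G / N) by ring.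
  apply: ler_wpM2r; first by rewrite divr_ge0 ?mulr_ge0 ?ltW.
  by rewrite ler_pdivrMr// ler_pM ?sqr_ge0.
have h2 : 3 * (2 * (2 * L).+1%:R) <= 249 * G / N.
  rewrite ler_pdivlMr// -[(2 * L).+1%:R]natr1 natrM -/l.
  apply: (@le_trans _ _ (18 * l * N)); first by apply: ler_wpM2r; [exact: ltW | lra].
  apply: (@le_trans _ _ (18 * l * (4 * l ^+ 2))).
    by rewrite ler_wpM2l ?mulr_ge0// (le_trans ler01).
  have -> : 18 * l * (4 * l ^+ 2) = 72 * l ^+ 3 by ring.
  by lra.
have -> : 441 * G / N = 249 * G / N + 3 * (64 * G / N) by ring.
by rewrite mulrDr lerD// ler_pM2l.
Qed.

(** A lower bound for [lam - H] in a frame cannot exceed the precision of an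
    approximate eigenvector of [h] by more than the localization error. *)
Lemma frame_comparison (a1 am1 b1 bm1 lam : R[i]) (M eps kappa : R) (n p : nat)
    (x : 'cV[R[i]]_n) (xi : X) :
  rnorm a1 <= M -> rnorm am1 <= M -> rnorm b1 <= M -> rnorm bm1 <= M ->
  (0 < n)%N -> `|theta - p%:R / n%:R| <= (2 * n%:R)^-1 ->
  xi != 0 -> 0 < eps -> 0 <= kappa -> 0 < enorm x ->
  enorm ((lam%:M - rotation_mx n p a1 am1 b1 bm1) *m x) <= eps * enorm x ->
  (forall y, kappa * rnorm y <= rnorm (lam *: y - frame_op F a1 am1 b1 bm1 y)) ->
  kappa <= eps + M * (21 / Num.sqrt n%:R).
Proof.
move=> aM amM bM bmM; case: n x => // n' x _; set n := n'.+1 => hp xi0 e0 k0 x0 hx lb.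
have [L [L0 Ln nL]] := @nat_sqrt_floor n isT.
have [G0 hK] := tent_constants L0 Ln nL.
have N0 : 0 < n%:R :> R by rewrite ltr0n.
have M0 : 0 <= M by apply: le_trans aM; exact: rnorm_ge0.
apply: (@localization R theta eps M _ (pi * L%:R / n%:R) kappa n p L (periodize x)
  a1 am1 b1 bm1 lam) => //.
- by rewrite divr_gt0// sqrtr_gt0.
- exact: periodizeD.
- apply: le_trans (ler_wpM2r _ hp) _; first by rewrite !mulr_ge0 ?pi_ge0.
  by rewrite le_eqVlt; apply/orP; left; apply/eqP; field; rewrite gt_eqF.
- rewrite (eq_bigr (fun k : 'I_n => rnorm (periodize x (k + 0)) ^+ 2)) => [|k _].
    by rewrite -sqr_enorm_periodize exprn_gt0.
  by rewrite addn0.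
- rewrite [X in _ <= _ * X](eq_bigr
    (fun k : 'I_n => rnorm (periodize x (k + 0)) ^+ 2)) => [|k _].
    rewrite -sqr_enorm_periodize -exprMn.
    rewrite [leLHS](eq_bigr (fun k : 'I_n => rnorm (periodize
      ((lam%:M - rotation_mx n p a1 am1 b1 bm1) *m x) (k + 1)) ^+ 2)) => [|k _].
      by rewrite -sqr_enorm_periodize ler_sqr ?nnegrE ?enorm_ge0// mulr_ge0 ?enorm_ge0// ltW.
    congr (rnorm _ ^+ 2); rewrite addn1 -periodize_rotation_mx mulmxBl mul_scalar_mx.
    by rewrite /periodize !mxE.
  by rewrite addn0.
- move=> c z z1 c0 cW.
  exact: (lower_bound_transfer theta_gt0 theta_irr xi0 z1 k0 c0 cW lb).
Qed.

End Comparison.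

(** * Norms of resolvents of normal elements *)

Section CStarNorm.
Variables (R : realType) (A : cstarAlg R).
Implicit Types (x y a b : A) (z : R[i]).

Lemma rnorm_mul x y : rnorm (x * y) <= rnorm x * rnorm y.
Proof. by rewrite -lecR rmorphM /= !rnormE; exact: cstar_normM. Qed.

Lemma starK x : star (star x) = x. Proof. exact: cstar_starK. Qed.
Lemma starM x y : star (x * y) = star y * star x. Proof. exact: cstar_starM. Qed.
Lemma starD x y : star (x + y) = star x + star y. Proof. exact: cstar_starD. Qed.
Lemma starZ z x : star (z *: x) = z^* *: star x. Proof. exact: cstar_starZ. Qed.
Lemma star1 : star (1 : A) = 1.
Proof. by rewrite -[RHS]starK -[in RHS](mul1r (star 1)) starM starK mul1r. Qed.

Lemma rnorm_starM x : rnorm (star x * x) = rnorm x ^+ 2.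
Proof.
by apply: (@complexI R); rewrite rmorphXn /= !rnormE; exact: cstar_identity.
Qed.

Lemma rnorm_star x : rnorm (star x) = rnorm x.
Proof.
suff le y : rnorm y <= rnorm (star y).
  by apply/le_anti; rewrite le andbT -[in leRHS](starK x) le.
have [->|y0] := eqVneq y 0; first by rewrite rnorm0 rnorm_ge0.
have : rnorm y * rnorm y <= rnorm (star y) * rnorm y.
  by rewrite -expr2 -rnorm_starM rnorm_mul.
by rewrite ler_pM2r ?rnorm_gt0.
Qed.

Lemma rnorm_one : rnorm (1 : A) = 1.
Proof.
have n0 : 0 < rnorm (1 : A) by rewrite rnorm_gt0 oner_neq0.
have := rnorm_starM 1; rewrite star1 mulr1 expr2 => /esym.
by rewrite -[RHS]mul1r => /(mulIf _) ->//; rewrite gt_eqF.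
Qed.

Lemma starX x k : star (x ^+ k) = star x ^+ k.
Proof. by elim: k => [|k IH]; rewrite ?expr0 ?star1// exprS exprSr starM IH. Qed.

Lemma normalX b k : normal b -> normal (b ^+ k).
Proof. by move=> nb; rewrite /normal starX; apply/commrX/commr_sym/commrX/commr_sym. Qed.

(** The C*-identity applied to [b^2], to [b] and to [star b * b]. *)
Lemma rnorm_normal_sqr b : normal b -> rnorm (b ^+ 2) = rnorm b ^+ 2.
Proof.
move=> nb; apply/eqP; rewrite -(eqrXn2 (_ : (0 < 2)%N)) ?rnorm_ge0 ?sqr_ge0//.
rewrite -(rnorm_starM (b ^+ 2)) -(rnorm_starM b) -(rnorm_starM (star b * b)).
rewrite !starM starK ?expr2 !mulrA.
by rewrite -[star b * b * star b]mulrA -nb mulrA.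
Qed.

Lemma rnorm_normalX2 b k : normal b -> rnorm (b ^+ (2 ^ k)) = rnorm b ^+ (2 ^ k).
Proof.
move=> nb; elim: k => [//|k IH].
by rewrite expnSr !exprM rnorm_normal_sqr ?IH//; exact: normalX.
Qed.

Lemma normal_inv d b : normal d -> d * b = 1 -> b * d = 1 -> normal b.
Proof.
move=> nd db bd; rewrite /normal.
have sdb : star d * star b = 1 by rewrite -starM bd star1.
have sbd : star b * star d = 1 by rewrite -starM db star1.
have e1 : star b * b * (d * star d) = 1.
  by rewrite mulrA -[_ * b * d]mulrA bd mulr1.
have e2 : d * star d * (b * star b) = 1.
  by rewrite -nd mulrA -[_ * d * b]mulrA db mulr1.
by rewrite -[LHS]mulr1 -e2 mulrA e1 mul1r.
Qed.

End CStarNorm.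

(** Bernoulli's inequality. *)
Lemma powers_small (R : realType) (delta e : R) : 0 < delta <= 1 -> 0 < e ->
  exists k, (1 - delta) ^+ k <= e.
Proof.
move=> /andP[d0 d1] e0.
have bern k : (1 - delta) ^+ k * (1 + k%:R * delta) <= 1.
  elim: k => [|k IH]; first by rewrite expr0 mul0r addr0 mulr1.
  apply: le_trans IH; rewrite exprSr -mulrA ler_wpM2l ?exprn_ge0 ?subr_ge0//.
  have := ler0n R k; rewrite -natr1; nra.
pose k := (Num.trunc ((e * delta)^-1)).+1.
have hk : (e * delta)^-1 < k%:R by exact: truncnS_gt.
exists k; have := bern k; set u := (1 - delta) ^+ k => h.
have u0 : 0 <= u by rewrite exprn_ge0// subr_ge0.
have h2 : 1 < k%:R * (e * delta).
  by rewrite -ltr_pdivrMr ?mulr_gt0// mul1r.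
rewrite leNgt; apply/negP => eu; nra.
Qed.

Section NormalResolvent.
Variables (R : realType) (A : cstarAlg R) (b : A) (r : R).
Hypotheses (nb : normal b).
Hypothesis inv : forall t : R[i], rnorm t < r ->
  exists c : A, (1 - t *: b) * c = 1 /\ c * (1 - t *: b) = 1.

(** Averaging the inverses of [1 - a] and [1 + a] inverts [1 - a^2]; iterated, it
    inverts [1 - (z b)^(2^k)] by an average of resolvents on a circle, with no
    loss in norm. *)
Lemma doubled_inverse (a G1 G2 : A) : (1 - a) * G1 = 1 -> (1 + a) * G2 = 1 ->
  (1 - a ^+ 2) * ((2^-1 : R[i]) *: (G1 + G2)) = 1.
Proof.
move=> h1 h2.
have e1 : 1 - a ^+ 2 = (1 + a) * (1 - a).
  by rewrite mulrBr mulr1 mulrDl mul1r expr2 opprD addrA addrK.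
have e2 : 1 - a ^+ 2 = (1 - a) * (1 + a).
  by rewrite mulrDr mulr1 mulrBl mul1r expr2 addrA subrK.
rewrite -scalerAr mulrDr [in X in X + _]e1 e2 -!mulrA h1 h2 !mulr1.
rewrite addrACA subrr addr0.
have -> : 1 + 1 = (2 : R[i]) *: (1 : A) by rewrite scalerDl scale1r.
by rewrite scalerA mulVf ?scale1r// pnatr_eq0.
Qed.

(** This is the spectral radius formula for a normal element.  If it fails, the
    circle of radius [t0 = 1 / |b|] lies inside the domain of the resolvent, so
    the resolvent is bounded there, and it varies by at most [1/4] when the circle
    is shrunk by a factor [s < 1] close to [1].  Averaging over roots of unity,
    the inverses [G], [G'] of [1 - a] and [1 - s^N a], where [a = (t0 b)^N] and
    [N = 2^k], are still within [1/4] of each other.  For large [k] the second is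
    close to [1], hence [G] is within [1/2] of [1]; but [|a| = 1] by normality,
    and [a = (G - 1) - a (G - 1)]. *)
Lemma rnorm_normal_resolvent : rnorm b * r <= 1.
Proof.
rewrite leNgt; apply/negP => br1.
have b0 : 0 < rnorm b.
  rewrite lt_neqAle rnorm_ge0 andbT; apply/eqP => b0; move: br1.
  by rewrite -b0 mul0r ltr10.
pose t0 := (rnorm b)^-1.
have t0_gt0 : 0 < t0 by rewrite invr_gt0.
have t0b : t0 * rnorm b = 1 by rewrite mulVf// gt_eqF.
have t0r : t0 < r by rewrite -(ltr_pM2l b0) [_ * t0]mulrC t0b.
have /choice[Rc hRc] : forall t : R[i], exists c : A,
    rnorm t < r -> (1 - t *: b) * c = 1 /\ c * (1 - t *: b) = 1.
  move=> t; have [/inv[c hc]|nt] := boolP (rnorm t < r); first by exists c.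
  by exists 0.
have resolvent t t' : rnorm t < r -> rnorm t' < r ->
    rnorm (Rc t - Rc t') <= rnorm (t - t') * rnorm b * (rnorm (Rc t) * rnorm (Rc t')).
  move=> /hRc[h1 _] /hRc[_ h2].
  have -> : Rc t - Rc t' = Rc t' * ((t - t') *: b) * Rc t.
    have -> : (t - t') *: b = (1 - t' *: b) - (1 - t *: b).
      by rewrite opprB [RHS]addrC subrKA scalerBl.
    by rewrite mulrBr mulrBl h2 mul1r -mulrA h1 mulr1.
  apply: le_trans (rnorm_mul _ _) _.
  rewrite mulrC [leRHS]mulrCA ler_wpM2l ?rnorm_ge0//.
  apply: le_trans (rnorm_mul _ _) _.
  by rewrite rnormZ mulrC.
have Rc_gt0 t : rnorm t < r -> 0 < rnorm (Rc t).
  move=> /hRc[h _]; rewrite rnorm_gt0; apply/eqP => R0; move: h.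
  by rewrite R0 mulr0 => /eqP; rewrite eq_sym oner_eq0.
pose z (phi : R) := real_complex R t0 * cexp2pi phi.
have nz phi : rnorm (z phi) = t0.
  by rewrite rnormM rnorm_cexp2pi mulr1 rnorm_real ger0_norm// ltW.
have zr phi : rnorm (z phi) < r by rewrite nz.
(* the reciprocal of the norm of the resolvent is Lipschitz by the resolvent
   identity, so it attains a positive minimum on the circle *)
pose psi phi := (rnorm (Rc (z phi)))^-1.
have lip phi phi' : `|psi phi - psi phi'| <= 2 * pi * `|phi - phi'|.
  have dz : rnorm (z phi - z phi') * rnorm b <= 2 * pi * `|phi - phi'|.
    rewrite /z -mulrBr rnormM rnorm_real ger0_norm ?(ltW t0_gt0)//.
    by rewrite mulrAC t0b mul1r rnorm_cexp2piB.
  apply: le_trans dz; have := resolvent _ _ (zr phi) (zr phi').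
  have := Rc_gt0 _ (zr phi); have := Rc_gt0 _ (zr phi').
  rewrite /psi; set u := Rc (z phi); set v := Rc (z phi') => v0 u0 h.
  have h1 : `|rnorm v - rnorm u| <= rnorm (u - v).
    rewrite ler_norml; apply/andP; split.
      by have := rnormD (u - v) v; rewrite subrK; lra.
    by have := rnormB u (u - v); rewrite subKr; lra.
  have -> : (rnorm u)^-1 - (rnorm v)^-1 = (rnorm v - rnorm u) / (rnorm u * rnorm v).
    by field; rewrite !gt_eqF.
  rewrite normrM normfV [`|_ * rnorm v|]ger0_norm ?mulr_ge0 ?rnorm_ge0//.
  by rewrite ler_pdivrMr ?mulr_gt0// (le_trans h1).
have psi_cont : {within `[0, 1], continuous psi}.
  apply: continuous_subspaceT => x.
  have pi0 : 0 < 2 * pi :> R by rewrite mulr_gt0// pi_gt0.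
  apply/cvgrPdist_le => e e0; apply/nbhs_ballP; exists (e / (2 * pi)) => /=.
    by rewrite divr_gt0.
  move=> y /=; rewrite /ball/= ltr_pdivlMr// mulrC => hy.
  exact: le_trans (lip _ _) (ltW hy).
have [c _ hc] := EVT_min ler01 psi_cont.
pose B := (psi c)^-1.
have B0 : 0 < B by rewrite !invr_gt0; apply: Rc_gt0.
have RcB phi : 0 <= phi <= 1 -> rnorm (Rc (z phi)) <= B.
  move=> hphi; have /hc : phi \in `[0, 1] by rewrite in_itv.
  by rewrite /B => h; rewrite -[leLHS]invrK lef_pV2// posrE invr_gt0 Rc_gt0.
(* small enough for [delta * B <= 1/8] and [delta * B * (2 * B) <= 1/4] *)
pose delta := (8 * (B + 1) ^+ 2)^-1.
have delta0 : 0 < delta by rewrite invr_gt0 mulr_gt0// exprn_gt0// addr_gt0.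
have dB : delta * (8 * (B + 1) ^+ 2) = 1 by rewrite mulVf// gt_eqF// -invr_gt0.
have delta1 : delta <= 1 by nra.
pose s := real_complex R (1 - delta).
have sn : rnorm s = 1 - delta by rewrite rnorm_real ger0_norm// subr_ge0.
(* the range of [phi] shrinks with [k] so that [phi + 2^-(k+1)], whose point on
   the circle has the opposite [2^k]-th power, stays in the previous range *)
have main k phi : 0 <= phi <= 2^-1 ^+ k -> exists G G' : A,
    [/\ (1 - (z phi *: b) ^+ (2 ^ k)) * G = 1,
        (1 - (s * z phi *: b) ^+ (2 ^ k)) * G' = 1 & rnorm (G - G') <= 4^-1].
  elim: k phi => [|k IH] phi hphi.
    rewrite expr0 in hphi.
    have szr : rnorm (s * z phi) < r.
      rewrite rnormM sn nz; apply: le_lt_trans t0r.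
      by rewrite ler_piMl ?(ltW t0_gt0)// gerBl ltW.
    exists (Rc (z phi)), (Rc (s * z phi)); rewrite !expr1.
    split; [by have [] := hRc _ (zr phi) | by have [] := hRc _ szr |].
    have dz : rnorm (z phi - s * z phi) * rnorm b = delta.
      have -> : z phi - s * z phi = real_complex R delta * z phi.
        by rewrite /s rmorphB /= rmorph1; ring.
      by rewrite rnormM rnorm_real ger0_norm ?(ltW delta0)// nz -mulrA t0b mulr1.
    have := resolvent _ _ (zr phi) szr; rewrite dz.
    have := RcB _ hphi; have := Rc_gt0 _ (zr phi); have := Rc_gt0 _ szr.
    have := rnormB (Rc (z phi)) (Rc (z phi) - Rc (s * z phi)); rewrite subKr.
    set u := rnorm (Rc (z phi)); set v := rnorm (Rc (s * z phi)); set w := rnorm _.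
    move=> h1 v0 u0 uB h2.
    have uv : delta * (u * v) <= delta * B * v.
      by rewrite -mulrA ler_wpM2l ?(ltW delta0)// ler_wpM2r// ltW.
    have dB2 : delta * B <= 8^-1 by nra.
    have v2 : v <= 2 * B by nra.
    have : delta * B * v <= delta * B * (2 * B).
      by rewrite ler_wpM2l// mulr_ge0// ltW.
    have : delta * B * (2 * B) <= 4^-1 by nra.
    lra.
  have half0 : 0 <= 2^-1 ^+ k.+1 :> R by rewrite exprn_ge0// invr_ge0.
  have halfS : 2^-1 ^+ k = 2^-1 ^+ k.+1 + 2^-1 ^+ k.+1 :> R by rewrite exprS; lra.
  have [|G1 [G1' [h1 h1' d1]]] := IH phi; first by move: hphi; lra.
  have [|G2 [G2' [h2 h2' d2]]] := IH (phi + 2^-1 ^+ k.+1); first by move: hphi; lra.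
  have zneg : z (phi + 2^-1 ^+ k.+1) ^+ (2 ^ k) = - z phi ^+ (2 ^ k).
    rewrite /z cexp2piD mulrA exprMn -[cexp2pi (2^-1 ^+ _) ^+ _]cexp2piMn.
    rewrite natrX exprS mulrCA -exprMn divff ?expr1n ?mulr1 ?pnatr_eq0//.
    by rewrite cexp2pi_half mulrN1.
  exists ((2^-1 : R[i]) *: (G1 + G2)), ((2^-1 : R[i]) *: (G1' + G2')); split.
  - rewrite expnSr exprM doubled_inverse//.
    by move: h2; rewrite !exprZn zneg scaleNr opprK.
  - rewrite expnSr exprM doubled_inverse//.
    move: h2'; rewrite !exprZn [(s * z (phi + _)) ^+ _]exprMn [(s * z phi) ^+ _]exprMn.
    by rewrite zneg mulrN scaleNr opprK.
  - rewrite -scalerBr rnormZ opprD addrACA.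
    have -> : rnorm (2^-1 : R[i]) = 2^-1 by rewrite rnormV rnorm_nat.
    by have := rnormD (G1 - G1') (G2 - G2'); lra.
have [k hk] : exists k, (1 - delta) ^+ k <= 8^-1.
  by apply: powers_small; rewrite ?delta0 ?delta1// invr_gt0.
have sN : rnorm (s ^+ (2 ^ k)) <= 8^-1.
  rewrite rnormX sn; apply: le_trans hk; rewrite ler_wiXn2l ?subr_ge0//.
    by rewrite gerBl ltW.
  exact/ltnW/ltn_expl.
have [|G [G' []]] := main k 0; first by rewrite lexx exprn_ge0// invr_ge0.
rewrite -scalerA [(s *: _) ^+ _]exprZn.
set a := (z 0 *: b) ^+ (2 ^ k) => hG hG' GG'.
have a1 : rnorm a = 1.
  by rewrite /a exprZn rnormZ rnormX nz rnorm_normalX2// -exprMn t0b expr1n.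
have eG' : G' - 1 = (s ^+ (2 ^ k) *: a) * G'.
  by rewrite -hG' mulrBl mul1r opprB addrC subrK.
have eG : G - 1 = a * G by rewrite -hG mulrBl mul1r opprB addrC subrK.
have nG' : rnorm (G' - 1) <= 8^-1 * rnorm G'.
  rewrite eG'; apply: le_trans (rnorm_mul _ _) _.
  by rewrite ler_wpM2r ?rnorm_ge0// rnormZ a1 mulr1.
have := rnormD (G' - 1) 1; rewrite subrK rnorm_one => h1.
have := rnormD (G - G') (G' - 1); rewrite addrA subrK => h2.
have ea : a = a * G - a * (G - 1) by rewrite mulrBr mulr1 subKr.
have := rnormB (a * G) (a * (G - 1)); rewrite -ea a1 -eG.
have := rnorm_mul a (G - 1); rewrite a1 mul1r => h3 h4.
lra.
Qed.

End NormalResolvent.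

(** * The two frames and the theorem *)

Section HilbertFrame.
Variables (R : realType) (K : hilbertSpace R).
Implicit Types x y : K.
Let ipK : K -> K -> R[i]^o := fun x y => @inner R K x y.

(** Pythagoras for the projection [t *: y] of [x] on the line of [y]. *)
Lemma inner_CauchySchwarz x y : rnorm (ipK x y) <= rnorm x * rnorm y.
Proof.
have [->|y0] := eqVneq y 0.
  by rewrite /ipK linear0r !rnorm0 mulr0.
rewrite -ler_sqr ?nnegrE ?mulr_ge0 ?rnorm_ge0//.
rewrite -lecR exprMn [leRHS]rmorphM /= !rmorphXn /= !rnormE !inner_norm.
pose g u v : R[i] := inner K u v.
have yy : 0 < g y y by rewrite dnorm_gt0.
pose t := g x y / g y y.
have wy : g (x - t *: y) y = 0.
  by rewrite /g linearBl linearZl_LR /= -/(g _ _) /t divfK ?subrr// gt_eqF.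
have yw : g (t *: y) (x - t *: y) = 0.
  rewrite /g linearZl_LR /= -/(g _ _); apply/eqP; rewrite mulf_eq0; apply/orP; right.
  by rewrite /g herm_eq0C; apply/eqP.
have : `|t| ^+ 2 * g y y <= g x x.
  have := dnormD (@inner R K) (t *: y) (x - t *: y).
  rewrite /= -!/(g _ _) yw conjC0 !addr0 addrC subrK => ->.
  by rewrite -dnormZ lerDl dnorm_ge0.
rewrite /t normrM normfV (ger0_norm (ltW yy)) exprMn exprVn [g y y ^+ 2]expr2.
by rewrite invfM mulrA divfK ?gt_eqF// ler_pdivrMr.
Qed.

Variables (theta : R) (A : cstarAlg R) (U V : A) (rho : representation A K).
Hypothesis pair : rotation_pair theta U V.

Lemma rep_unitaryK (u v : A) : u * v = 1 -> cancel (rho v) (rho u).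
Proof. by move=> uv x; rewrite -repM uv rep1. Qed.

Lemma rep_unitary_ip (u : A) : unitary u ->
  forall x y, ipK (rho u x) (rho u y) = ipK x y.
Proof. by move=> [su _] x y; rewrite /ipK rep_star -repM su rep1. Qed.

Lemma representation_frame : exists F : rotation_frame theta K (R[i]^o),
  forall (a1 am1 b1 bm1 : R[i]) x,
    frame_op F a1 am1 b1 bm1 x = rho (rotation_elt U V a1 am1 b1 bm1) x.
Proof.
have [[UsU UUs] [VsV VVs] UV] := pair.
unshelve eexists; first unshelve refine (@RotationFrame R theta K (R[i]^o)
  (rho U) (rho (star U)) (rho V) (rho (star V)) ipK _ _ _ _ _ _ _ _ _ _ _ _ _).
- exact: rep_unitaryK.
- exact: rep_unitaryK.
- exact: rep_unitaryK.
- exact: rep_unitaryK.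
- by move=> x; rewrite -!repM UV repZ.
- by move=> x y z; rewrite /ipK linearDl.
- by move=> x y z; rewrite /ipK linearDr.
- by move=> c x y; rewrite /ipK linearZl_LR.
- by move=> c x y; rewrite /ipK linearZr_LR.
- exact: rep_unitary_ip.
- exact: rep_unitary_ip.
- exact: inner_CauchySchwarz.
- move=> x; apply: (@complexI R); rewrite rmorphXn /= !rnormE inner_norm.
  by rewrite ger0_norm// dnorm_ge0.
- by move=> *; rewrite /frame_op /rotation_elt !repD !repZ.
Qed.

End HilbertFrame.

Section AlgebraFrame.
Variables (R : realType) (theta : R) (A : cstarAlg R) (U V : A).
Hypothesis pair : rotation_pair theta U V.

Lemma left_mulK (u v : A) : u * v = 1 -> cancel (v \*o idfun) (u \*o idfun).
Proof. by move=> uv x; rewrite /= mulrA uv mul1r. Qed.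

Lemma left_mul_ip (u x y : A) : unitary u ->
  star ((u \*o idfun) y) * (u \*o idfun) x = star y * x.
Proof. by move=> [su _]; rewrite /= starM mulrA -[_ * _ * u]mulrA su mulr1. Qed.

Lemma left_frame : exists F : rotation_frame theta A A,
  forall (a1 am1 b1 bm1 : R[i]) x,
    frame_op F a1 am1 b1 bm1 x = rotation_elt U V a1 am1 b1 bm1 * x.
Proof.
have [[UsU UUs] [VsV VVs] UV] := pair.
unshelve eexists; first unshelve refine (@RotationFrame R theta A A
  (U \*o idfun) (star U \*o idfun) (V \*o idfun) (star V \*o idfun) (fun x y => star y * x)
  _ _ _ _ _ _ _ _ _ _ _ _ _).
- exact: left_mulK.
- exact: left_mulK.
- exact: left_mulK.
- exact: left_mulK.
- move=> x; change (U * (V * x) = cexp2pi theta *: (V * (U * x))).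
  by rewrite !mulrA UV -scalerAl.
- by move=> x y z; rewrite mulrDr.
- by move=> x y z; rewrite starD mulrDl.
- by move=> c x y; rewrite scalerAr.
- by move=> c x y; rewrite starZ scalerAl.
- by move=> x y; exact: (left_mul_ip x y (conj UsU UUs)).
- by move=> x y; exact: (left_mul_ip x y (conj VsV VVs)).
- by move=> x y; rewrite [leRHS]mulrC -(rnorm_star y); exact: rnorm_mul.
- exact: rnorm_starM.
- by move=> *; rewrite /frame_op /rotation_elt !mulrDl -!scalerAl.
Qed.

End AlgebraFrame.

Section OpNorm.
Variables (R : realType) (K : hilbertSpace R) (S : {linear K -> K}).
Hypothesis bS : bounded_op S.

Lemma rnorm_le_opnorm x : rnorm (S x) <= opnorm S * rnorm x.
Proof.
have [->|x0] := eqVneq x 0; first by rewrite linear0 !rnorm0 mulr0.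
have nx : 0 < rnorm x by rewrite rnorm_gt0.
rewrite -ler_pdivrMr//.
have c0 : 0 <= (rnorm x)^-1 by rewrite invr_ge0 rnorm_ge0.
apply: sup_ubound.
  have [M hM] := bS; exists (Num.max M 0) => _ [y /= y1 <-].
  apply: le_trans (hM y) _; apply: (@le_trans _ _ (Num.max M 0 * rnorm y)).
    by rewrite ler_wpM2r ?rnorm_ge0// le_max lexx.
  by rewrite ler_piMr// le_max lexx orbT.
exists ((real_complex R (rnorm x)^-1) *: x) => /=.
  by rewrite rnormZ rnorm_real ger0_norm// mulVf// gt_eqF.
by rewrite linearZ /= rnormZ rnorm_real ger0_norm// mulrC.
Qed.

End OpNorm.

Section MatrixVectors.
Variables (R : realType) (n : nat).
Implicit Types (B : 'M[R[i]]_n).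

Lemma enorm0 : enorm (0 : 'cV[R[i]]_n) = 0.
Proof. by rewrite /enorm big1 ?sqrtr0// => i _; rewrite mxE rnorm0 expr0n. Qed.

Lemma enorm_gt0 (x : 'cV[R[i]]_n) : (0 < enorm x) = (x != 0).
Proof.
rewrite lt_neqAle enorm_ge0 andbT eq_sym; congr (~~ _).
apply/eqP/eqP => [e|->]; last exact: enorm0.
have := sqr_enorm x; rewrite e expr0n /= => /esym/eqP.
rewrite psumr_eq0 => [|i _]; last exact: sqr_ge0.
move=> /allP h; apply/colP => i; rewrite mxE.
have := h i (mem_index_enum _); rewrite /= sqrf_eq0 rnorm_eq0 => /eqP //.
Qed.

Lemma singular_kernel B : B \notin unitmx -> exists2 x : 'cV_n, x != 0 & B *m x = 0.
Proof.
rewrite -unitmx_tr -row_free_unit -kermx_eq0 => k0.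
exists (nz_row (kermx B^T))^T.
  by rewrite -(inj_eq trmx_inj) trmxK trmx0 nz_row_eq0.
apply: trmx_inj; rewrite trmx_mul trmxK trmx0.
exact/sub_kermxP/nz_row_sub.
Qed.

(** The norm of the inverse is a supremum over the unit ball; any value close to
    it is attained at some [y], and the image of [y] under the inverse is an
    approximate eigenvector.  Asking only for [e > eps] makes an almost maximal
    [y] sufficient. *)
Lemma pseudospectrum_vector (h : 'M[R[i]]_n) (lam : R[i]) (eps e : R) :
  mx_pseudospectrum h eps lam -> 0 < eps < e ->
  exists2 x, 0 < enorm x & enorm ((lam%:M - h) *m x) <= e * enorm x.
Proof.
move=> hl /andP[eps0 epse]; have e0 : 0 < e := lt_trans eps0 epse.
have [u|nu] := boolP (lam%:M - h \in unitmx); last first.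
  have [x x0 hx] := singular_kernel nu; exists x; first by rewrite enorm_gt0.
  by rewrite hx enorm0 mulr_ge0 ?enorm_ge0// ltW.
set B := invmx (lam%:M - h).
have [y [y1 hy]] : exists y : 'cV_n, enorm y <= 1 /\ e^-1 < enorm (B *m y).
  apply: contrapT => H.
  have : mx_opnorm B <= e^-1.
    apply: ge_sup; first by exists (enorm (B *m 0)), 0 => //=; rewrite enorm0.
    by move=> _ [y /= y1 <-]; rewrite leNgt; apply/negP => hy; apply: H; exists y.
  have := hl u; rewrite -/B => h1 h2.
  have := le_trans h1 h2; rewrite lef_pV2 ?posrE//.
  by rewrite leNgt epse.
have By0 : 0 < enorm (B *m y) by apply: lt_trans hy; rewrite invr_gt0.
exists (B *m y) => //; rewrite mulmxA mulmxV// mul1mx (le_trans y1)//.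
by rewrite mulrC -ler_pdivrMr// div1r ltW.
Qed.

End MatrixVectors.

Lemma normal_scalarB (R : realType) (A : cstarAlg R) (s : R[i]) (x : A) :
  normal x -> normal (s%:A - x).
Proof.
have central (k : R[i]) (y : A) : GRing.comm y k%:A.
  by rewrite /GRing.comm -scalerAr -scalerAl mulr1 mul1r.
have starE : star (s%:A - x) = (s^*)%:A - star x.
  by rewrite starD starZ star1 -scaleN1r starZ rmorphN1 scaleN1r.
move=> nx; apply: commrB; first exact: central.
apply: commr_sym; rewrite starE; apply: commrB; first exact: central.
exact: esym nx.
Qed.

Theorem theorem5p2 (R : realType) (theta : R) (theta_itv : 0 < theta < 1)
    (theta_irr : irrational theta)
    (A : cstarAlg R) (U V : A) (AUV : rotation_algebra theta U V)
    (a1 am1 b1 bm1 : R[i]) :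
  let M : R := Num.max (Num.max (rnorm a1) (rnorm am1))
                       (Num.max (rnorm b1) (rnorm bm1)) in
  let H : A := rotation_elt U V a1 am1 b1 bm1 in
  let h (n p : nat) : 'M[R[i]]_n := rotation_mx n p a1 am1 b1 bm1 in
  let admissible (n p : nat) : Prop :=
    [/\ (0 < n)%N, (p < n)%N & `|theta - p%:R / n%:R| <= (2 * n%:R)^-1] in
  (exists C1 : R,
     0 <= C1 <= 36 * M * Num.sqrt (3 * pi) /\
     forall n p : nat, admissible n p -> forall eps : R, 0 < eps ->
       mx_pseudospectrum (h n p) eps
         `<=` pseudospectrum H (eps + C1 / Num.sqrt n%:R))
  /\
  (normal H -> 0 < M ->
   exists C1 : R,
     0 < C1 <= 36 * M * Num.sqrt (3 * pi) /\
     forall n p : nat, admissible n p ->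
       subset_upto (C1 / Num.sqrt n%:R) (mx_spectrum (h n p)) (spectrum H)).
Proof.
move=> M H h adm.
have [pair _ _] := AUV; have th0 : 0 < theta by case/andP: theta_itv.
have aM : rnorm a1 <= M by rewrite !le_max lexx.
have amM : rnorm am1 <= M by rewrite !le_max lexx !orbT.
have bM : rnorm b1 <= M by rewrite !le_max lexx !orbT.
have bmM : rnorm bm1 <= M by rewrite !le_max lexx !orbT.
have M0 : 0 <= M := le_trans (rnorm_ge0 _) aM.
have s1 : 1 <= Num.sqrt (3 * pi) :> R.
  by rewrite -[leLHS]sqrtr1 ler_sqrt ?mulr_ge0 ?pi_ge0//; have := pi_ge2 R; lra.
have MC : M * 21 <= 36 * M * Num.sqrt (3 * pi) by nra.
have C0 : 0 <= 36 * M * Num.sqrt (3 * pi) by rewrite !mulr_ge0 ?sqrtr_ge0.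
have root0 n : (0 < n)%N -> 0 < Num.sqrt n%:R :> R by rewrite sqrtr_gt0 ltr0n.
split.
  exists (36 * M * Num.sqrt (3 * pi)); split; first by rewrite C0 lexx.
  move=> n p [n0 _ hp] eps eps0 lam hlam K rho frho S [bS SK KS].
  have [xi xi0] : exists xi : K, xi != 0.
    apply: contrapT => N; have := oner_neq0 A; rewrite (frho 1) ?eqxx// => x.
    by rewrite rep1; apply/eqP/negPn/negP => x0; apply: N; exists x.
  have T0 y : rnorm y <= opnorm S * rnorm (lam *: y - rho H y).
    by have := rnorm_le_opnorm bS (lam *: y - rho H y); rewrite SK.
  have S0 : 0 < opnorm S.
    rewrite ltNge; apply/negP => S0.
    have : rnorm xi <= 0 by apply: le_trans (T0 xi) _; rewrite mulr_le0_ge0 ?rnorm_ge0.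
    by rewrite leNgt rnorm_gt0 xi0.
  have : (opnorm S)^-1 <= eps + M * (21 / Num.sqrt n%:R).
    apply/ler_addgt0Pr => e e0.
    have [|x x0 hx] := @pseudospectrum_vector _ _ _ _ _ (eps + e) hlam.
      by rewrite eps0 ltrDl.
    rewrite addrAC.
    have [F FE] := representation_frame rho pair.
    apply: (frame_comparison (F := F) (lam := lam)
      th0 theta_irr aM amM bM bmM n0 hp xi0 _ _ x0 hx).
    - by rewrite addr_gt0.
    - by rewrite invr_ge0 ltW.
    - by move=> y; rewrite FE mulrC ler_pdivrMr// mulrC T0.
  move=> hS; rewrite -[leRHS]invrK lef_pV2 ?posrE ?invr_gt0//.
    by apply: le_trans hS _; rewrite lerD2l mulrA ler_wpM2r// invr_ge0 ltW// root0.
  by rewrite ltr_wpDr// divr_ge0// ltW// root0.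
move=> nH Mpos; exists (36 * M * Num.sqrt (3 * pi)).
have Cgt0 : 0 < 36 * M * Num.sqrt (3 * pi).
  by rewrite !mulr_gt0// (lt_le_trans ltr01).
split; first by rewrite Cgt0 lexx.
move=> n p [n0 _ hp] lam hlam.
set r := 36 * M * Num.sqrt (3 * pi) / Num.sqrt n%:R.
have r0 : 0 < r by rewrite divr_gt0// root0.
apply: contrapT => far.
have inv s : rnorm (lam - s) < r ->
    exists c : A, (s%:A - H) * c = 1 /\ c * (s%:A - H) = 1.
  by move=> hs; apply: contrapT => ns; apply: far; exists s.
have [b [db bd]] : exists b : A, (lam%:A - H) * b = 1 /\ b * (lam%:A - H) = 1.
  by apply: inv; rewrite subrr rnorm0.
have nd : normal (lam%:A - H) by exact: normal_scalarB.
have nb := normal_inv nd db bd.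
have br : rnorm b * r <= 1.
  apply: rnorm_normal_resolvent => // t ht.
  have [|c [h1 h2]] := inv (lam - t); first by rewrite subKr.
  have e1 : 1 - t *: b = b * ((lam - t)%:A - H).
    by rewrite scalerBl addrAC mulrBr bd -scalerAr mulr1.
  have e2 : (lam%:A - H) * (1 - t *: b) = (lam - t)%:A - H.
    by rewrite mulrBr mulr1 -scalerAr db scalerBl addrAC.
  exists (c * (lam%:A - H)); split.
    by rewrite e1 mulrA -[b * _ * c]mulrA h1 mulr1.
  by rewrite -mulrA e2.
(* an eigenvector of [h] serves for every [eps > 0] *)
have [x x0 hx] := singular_kernel hlam.
have : r <= M * (21 / Num.sqrt n%:R).
  apply/ler_addgt0Pr => e e0; rewrite addrC.
  have [F FE] := left_frame pair.
  apply: (frame_comparison (F := F) (lam := lam) (x := x) (xi := 1)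
    th0 theta_irr aM amM bM bmM n0 hp _ e0 (ltW r0)).
  - exact: oner_neq0.
  - by rewrite enorm_gt0.
  - by rewrite hx enorm0 mulr_ge0 ?enorm_ge0// ltW.
  - move=> y; rewrite FE.
    have -> : lam *: y - rotation_elt U V a1 am1 b1 bm1 * y = (lam%:A - H) * y.
      by rewrite mulrBl -scalerAl mul1r.
    have : rnorm y <= rnorm b * rnorm ((lam%:A - H) * y).
      by apply: le_trans (rnorm_mul _ _); rewrite mulrA bd mul1r.
    move=> hy; apply: le_trans (ler_wpM2l (ltW r0) hy) _.
    by rewrite mulrA ler_piMl ?rnorm_ge0// mulrC.
rewrite mulrA ler_pM2r ?invr_gt0 ?root0//.
by apply/negP; rewrite -ltNge; nra.
Qed.
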